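(* Let $T>0$, let $\varepsilon$ be a nonzero real number with $|\varepsilon|<1$, and let $\Omega=\{(x,t): -\pi<x<\pi,\ 0<t<T\}$. Let $\varphi,\psi\in C^2[-\pi,\pi]$ with $\varphi''',\psi'''\in L_2(-\pi,\pi)$ and $\varphi^{(i)}(-\pi)=\varphi^{(i)}(\pi)$, $\psi^{(i)}(-\pi)=\psi^{(i)}(\pi)$ for $i=0,1,2$. Consider the inverse problem of finding a pair $(u,f)$ with $u\in C^{2,1}_{x,t}(\Omega)$, $f\in C[-\pi,\pi]$, such that $$u_t(x,t)-u_{xx}(x,t)+\varepsilon u_{xx}(-x,t)=f(x),\quad (x,t)\in\Omega,$$ $$u(x,0)=\varphi(x),\quad u(x,T)=\psi(x),\quad x\in[-\pi,\pi],$$ $$u(-\pi,t)=u(\pi,t),\quad u_x(-\pi,t)=u_x(\pi,t),\quad t\in[0,T].$$ Then a unique solution of this problem exists, and it is given by $$u(x,t)=\varphi(x)+\frac tT(\psi_0-\varphi_0)-\sum_{k=1}^\infty\frac{\left(1-e^{-(1-\varepsilon)k^2t}\right)\left(\varphi^{(3)}_{2k}-\psi^{(3)}_{2k}\right)}{\left(1-e^{-(1-\varepsilon)k^2T}\right)k^3}\cos kx+\sum_{k=1}^\infty\frac{\left(1-e^{-(1+\varepsilon)k^2t}\right)\left(\varphi^{(3)}_{1k}-\psi^{(3)}_{1k}\right)}{\left(1-e^{-(1+\varepsilon)k^2T}\right)k^3}\sin kx,$$ $$f(x)=-\varphi''(x)+\varepsilon\varphi''(-x)+\frac{\psi_0-\varphi_0}{T}-\sum_{k=1}^\infty\frac{(1-\varepsilon)\left(\varphi^{(3)}_{2k}-\psi^{(3)}_{2k}\right)}{\left(1-e^{-(1-\varepsilon)k^2T}\right)k}\cos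 kx+\sum_{k=1}^\infty\frac{(1+\varepsilon)\left(\varphi^{(3)}_{1k}-\psi^{(3)}_{1k}\right)}{\left(1-e^{-(1+\varepsilon)k^2T}\right)k}\sin kx,$$ where $$\varphi_0=\frac1{2\pi}\int_{-\pi}^\pi\varphi(x)\,dx,\quad \psi_0=\frac1{2\pi}\int_{-\pi}^\pi\psi(x)\,dx,$$ $$\varphi^{(3)}_{1k}=\frac1\pi\int_{-\pi}^\pi\varphi'''(x)\cos kx\,dx,\quad \varphi^{(3)}_{2k}=\frac1\pi\int_{-\pi}^\pi\varphi'''(x)\sin kx\,dx,$$ $$\psi^{(3)}_{1k}=\frac1\pi\int_{-\pi}^\pi\psi'''(x)\cos kx\,dx,\quad \psi^{(3)}_{2k}=\frac1\pi\int_{-\pi}^\pi\psi'''(x)\sin kx\,dx.$$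
   Context: $C^{2,1}_{x,t}(\Omega)$ denotes functions on $\Omega$ that are twice continuously differentiable in $x$ and once continuously differentiable in $t$. A pair $(u,f)$ with $u\in C^{2,1}_{x,t}(\Omega)$, $f\in C[-\pi,\pi]$ satisfying the equation and conditions is called a regular solution.
   Formalization: Solutions are also required to have u and u_x continuous on the closed rectangle [-π,π]×[0,T] (u_x one-sided at x=±π); with only u∈C^{2,1}(Ω), uniqueness fails: for φ=ψ=0, f=0, both u=0 and u=1 for 0<t<T, u=0 at t=0,T, solve the problem. *)

(* Defs.v *)
From HB Require Import structures.
From mathcomp Require Import all_boot all_order all_algebra.
From mathcomp Require Import all_classical all_reals all_analysis.
Set Implicit Arguments. Unset Strict Implicit. Unset Printing Implicit Defensive.
Import Order.TTheory GRing.Theory Num.Theory.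
Import numFieldNormedType.Exports.
Local Open Scope classical_set_scope.
Local Open Scope ring_scope.

Section Defs.
Variable R : realType.

Definition Omega (T : R) : set (R * R) := `]-pi, pi[ `*` `]0, T[.
Definition Omega_bar (T : R) : set (R * R) := `[-pi, pi] `*` `[0, T].

Definition pdx (u : R -> R -> R) (x t : R) : R := derive1 (fun y => u y t) x.
Definition pdt (u : R -> R -> R) (x t : R) : R := derive1 (fun s => u x s) t.
Definition pdxx (u : R -> R -> R) (x t : R) : R := derive1 (fun y => pdx u y t) x.

Definition deriv_within (a b : R) (g : R -> R) (x l : R) : Prop :=
  (fun y => (g y - g x) / (y - x)) @
     within (`[a, b] `&` [set y | y != x]) (nbhs x) --> l.

Definition C2_on (a b : R) (g g1 g2 : R -> R) : Prop :=
  (forall x, a <= x <= b -> deriv_within a b g x (g1 x)) /\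
  (forall x, a <= x <= b -> deriv_within a b g1 x (g2 x)) /\
  {within `[a, b], continuous g2}.

Definition test_function (a b : R) (eta : R -> R) : Prop :=
  (forall n x, derivable (iter n (@derive1 R R) eta) x 1) /\
  exists2 d : R, 0 < d & forall x, (x <= a + d \/ b - d <= x) -> eta x = 0.

Definition weak_deriv_L2 (a b : R) (g2 g3 : R -> R) : Prop :=
  measurable_fun `[a, b] g3 /\
  (@lebesgue_measure R).-integrable `[a, b] (fun x => (g3 x ^+ 2)%:E) /\
  forall eta, test_function a b eta ->
    (\int[@lebesgue_measure R]_(x in `[a, b]) (g2 x * derive1 eta x)%:E =
     - \int[@lebesgue_measure R]_(x in `[a, b]) (g3 x * eta x)%:E)%E.

Definition regular_solution (T eps : R) (phi psi : R -> R)
  (u : R -> R -> R) (f : R -> R) : Prop :=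
  {within `[-pi, pi], continuous f} /\
  (forall x t, Omega T (x, t) ->
     [/\ derivable (fun s => u x s) t 1,
         derivable (fun y => u y t) x 1 &
         derivable (fun y => pdx u y t) x 1]) /\
  (forall p, Omega T p ->
     [/\ {for p, continuous (fun q : R * R => u q.1 q.2)},
         {for p, continuous (fun q : R * R => pdt u q.1 q.2)},
         {for p, continuous (fun q : R * R => pdx u q.1 q.2)} &
         {for p, continuous (fun q : R * R => pdxx u q.1 q.2)}]) /\
  {within Omega_bar T, continuous (fun q : R * R => u q.1 q.2)} /\
  (exists ux : R -> R -> R,
     [/\ (forall x t, Omega_bar T (x, t) ->
            deriv_within (-pi) pi (fun y => u y t) x (ux x t)),
         {within Omega_bar T, continuous (fun q : R * R => ux q.1 q.2)} &
         forall t, 0 <= t <= T -> ux (-pi) t = ux pi t]) /\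
  (forall x t, Omega T (x, t) ->
     pdt u x t - pdxx u x t + eps * pdxx u (- x) t = f x) /\
  (forall x, -pi <= x <= pi -> u x 0 = phi x /\ u x T = psi x) /\
  (forall t, 0 <= t <= T -> u (-pi) t = u pi t).

Definition mean0 (g : R -> R) : R :=
  (2 * pi)^-1 * Rintegral (@lebesgue_measure R) `[-pi, pi] g.
Definition coef_cos (g : R -> R) (k : nat) : R :=
  pi^-1 * Rintegral (@lebesgue_measure R) `[-pi, pi]
            (fun x => g x * cos (k%:R * x)).
Definition coef_sin (g : R -> R) (k : nat) : R :=
  pi^-1 * Rintegral (@lebesgue_measure R) `[-pi, pi]
            (fun x => g x * sin (k%:R * x)).

(* Terms of the series, indexed by n with k = n+1 (so the sums run k >= 1). *)
Definition u_cos_term (T eps : R) (phi3 psi3 : R -> R) (x t : R) (n : nat) : R :=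
  let k := n.+1 in
  (1 - expR (- (1 - eps) * k%:R ^+ 2 * t)) * (coef_sin phi3 k - coef_sin psi3 k)
  / ((1 - expR (- (1 - eps) * k%:R ^+ 2 * T)) * k%:R ^+ 3) * cos (k%:R * x).
Definition u_sin_term (T eps : R) (phi3 psi3 : R -> R) (x t : R) (n : nat) : R :=
  let k := n.+1 in
  (1 - expR (- (1 + eps) * k%:R ^+ 2 * t)) * (coef_cos phi3 k - coef_cos psi3 k)
  / ((1 - expR (- (1 + eps) * k%:R ^+ 2 * T)) * k%:R ^+ 3) * sin (k%:R * x).
Definition f_cos_term (T eps : R) (phi3 psi3 : R -> R) (x : R) (n : nat) : R :=
  let k := n.+1 in
  (1 - eps) * (coef_sin phi3 k - coef_sin psi3 k)
  / ((1 - expR (- (1 - eps) * k%:R ^+ 2 * T)) * k%:R) * cos (k%:R * x).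
Definition f_sin_term (T eps : R) (phi3 psi3 : R -> R) (x : R) (n : nat) : R :=
  let k := n.+1 in
  (1 + eps) * (coef_cos phi3 k - coef_cos psi3 k)
  / ((1 - expR (- (1 + eps) * k%:R ^+ 2 * T)) * k%:R) * sin (k%:R * x).

End Defs.

(* Main.v *)
(* The involution x |-> -x preserves even and odd functions, so on the modes cos (k x)
   and sin (k x) the equation decouples into U' + lam U = F with lam = (1 -+ eps) k^2
   and F constant in time; the values at t = 0 and t = T determine both U and F.

   Existence: the Fourier coefficients of phi''' and psi''' are square summable by
   Bessel's inequality, hence the coefficients of the series for u_xx and u_t are
   summable and the series may be differentiated term by term.  The value at t = T is
   psi because a continuous function is determined by its Fourier coefficients.

   Uniqueness: the mode equation is first derived on [-r, r], where u_t is bounded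
   locally in t, with boundary terms that tend to 0 uniformly in t as r -> pi; the mean
   value theorem then gives that exp (lam t) U(t) - F G(t), where G' = exp (lam t), is
   constant.  Two solutions thus have the same Fourier coefficients at every time. *)
Require Import Defs.
From HB Require Import structures.
From mathcomp Require Import all_boot all_order all_algebra.
From mathcomp Require Import ring lra.
From mathcomp Require Import all_classical all_reals all_analysis measurable_realfun.
Import Order.TTheory GRing.Theory Num.Theory.
Import numFieldNormedType.Exports.
Local Open Scope classical_set_scope.
Local Open Scope ring_scope.
Set Implicit Arguments.
Unset Strict Implicit.
Unset Printing Implicit Defensive.

(** Two obstacles shape the proof. The third derivatives [phi3] and [psi3] are only weak: they are
    tested on smooth functions that vanish near the end points, and the modes do not vanish there.
    Explicit smooth cutoffs built from exp (-1/z) bridge the gap, and the periodicity of the second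
    derivatives makes the derivatives of the cutoffs harmless. For uniqueness, the equation and the
    continuity of u_t and u_xx are available only in the open rectangle, so the boundary terms must
    be controlled through u and u_x alone. All trigonometric functions are written cos (k x - th).
    Differentiation multiplies by -k and adds pi / 2 to th, so one argument serves both parities.
    Three integrations by parts shift th by 3 pi / 2; this is why cos k x carries the sine
    coefficient of phi''' divided by k^3, and sin k x the cosine coefficient with the opposite
    sign. *)

(** * Dominated series: limits and derivatives term by term *)

Section Series.
Variable R : realType.
Implicit Types (u v M : nat -> R).

Lemma series_abs_cvg u M : (forall n, `|u n| <= M n) -> cvgn (series M) ->
  cvgn (series u).
Proof.
move=> uM cM; apply: normed_cvg; apply: series_le_cvg cM => //= n.
exact: le_trans (normr_ge0 _) (uM n).
Qed.

(** The bound involves only [M], hence it is uniform in every parameter on which [u] may depend. *)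
Lemma series_tail u M N : (forall n, `|u n| <= M n) -> cvgn (series M) ->
  `|limn (series u) - series u N| <= limn (series M) - series M N.
Proof.
move=> uM cM; have cu := series_abs_cvg uM cM.
apply: (@ler_cvg_to _ \oo _ _ (fun n => `|series u n - series u N|)
  (fun n => series M n - series M N)).
- by apply: cvg_norm; apply: cvgB => //; exact: cvg_cst.
- by apply: cvgB => //; exact: cvg_cst.
- near=> n.
  have Nn : (N <= n)%N by near: n; exact: nbhs_infty_ge.
  rewrite !sub_series Nn.
  by apply: le_trans (ler_norm_sum _ _ _) _; exact: ler_sum.
Unshelve. all: by end_near. Qed.

Lemma cvg_series_finite (I : Type) (F : set_system I) (FF : Filter F)
  (a : nat -> I -> R) (l : nat -> R) (N : nat) :
  (forall n, a n @ F --> l n) -> (fun i => series (a ^~ i) N) @ F --> series l N.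
Proof.
move=> al; elim: N => [|N IH].
  rewrite /series /= big_geq //.
  by under eq_fun do rewrite big_geq//; exact: cvg_cst.
rewrite seriesS; under eq_fun do rewrite seriesS.
exact: cvgD.
Qed.

(* Tannery's theorem *)
Lemma cvg_series_dominated (I : Type) (F : set_system I) (FF : Filter F)
  (a : nat -> I -> R) (l M : nat -> R) :
  (forall n, a n @ F --> l n) -> (forall n, `|l n| <= M n) ->
  (\forall i \near F, forall n, `|a n i| <= M n) ->
  cvgn (series M) ->
  (fun i => limn (series (a ^~ i))) @ F --> limn (series l).
Proof.
move=> al lM aM cM.
apply/cvgrPdist_le => e e0.
have e3 : 0 < e / 3 by lra.
have [N _ /(_ N (leqnn _)) HN] := (cvgrPdist_le _ _).1 cM _ e3.
have {}HN : limn (series M) - series M N <= e / 3.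
  exact: le_trans (ler_norm _) HN.
have aN := (cvgrPdist_le _ _).1 (cvg_series_finite _ al (N := N)) _ e3.
near=> i.
have ai : forall n, `|a n i| <= M n by near: i.
have lt := series_tail N lM cM.
have at_ := series_tail N ai cM.
have : `|series l N - series (a ^~ i) N| <= e / 3 by near: i; exact: aN.
move: lt at_; rewrite !ler_norml => /andP[? ?] /andP[? ?] /andP[? ?].
apply/andP; split; lra.
Unshelve. all: by end_near. Qed.

Lemma is_derive_quot (F : R -> R) (x l : R) :
  (fun h => (F (x + h) - F x) / h) @ 0^' --> l -> is_derive x 1 F l.
Proof.
move=> H.
have H' : (fun h => h^-1 *: ((F \o shift x) (h *: 1) - F x)) @ 0^' --> l.
  apply: cvg_trans H; apply: near_eq_cvg; near=> h.
  by rewrite /= scaler1 mulrC [h + x]addrC.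
by apply: DeriveDef; [apply/cvg_ex; exists l | exact/cvg_lim].
Unshelve. all: by end_near. Qed.

Lemma quot_is_derive (F : R -> R) (x l : R) :
  is_derive x 1 F l -> (fun h => (F (x + h) - F x) / h) @ 0^' --> l.
Proof.
case=> /cvg_ex[l' H] E.
have -> : l = l' by rewrite -E; exact/cvg_lim.
apply: cvg_trans H; apply: near_eq_cvg; near=> h.
by rewrite /= scaler1 mulrC [h + x]addrC.
Unshelve. all: by end_near. Qed.

Lemma mean_value_le (f df : R -> R) (a b C : R) :
  a <= b -> (forall y, a <= y <= b -> is_derive y 1 f (df y)) ->
  (forall y, a <= y <= b -> `|df y| <= C) -> `|f b - f a| <= C * (b - a).
Proof.
move=> ab dff dfC.
have [||c cab ->] := @MVT_segment R f df a b ab.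
- by move=> x; rewrite in_itv/= => /andP[ax xb]; apply: dff; rewrite !ltW.
- apply: derivable_within_continuous => x; rewrite in_itv/= => H.
  by have [] := dff x H.
rewrite normrM (ger0_norm (_ : 0 <= b - a)) ?subr_ge0//.
by apply: ler_wpM2r; rewrite ?subr_ge0// dfC.
Qed.

(** The limit of the difference quotients is taken under the sum by Tannery's theorem; the mean
    value inequality shows that the bound [M] on the derivatives also bounds the quotients. *)
Lemma is_derive_series (f g : nat -> R -> R) M (a b x : R) :
  a < x < b ->
  (forall n y, a < y < b -> is_derive y 1 (f n) (g n y)) ->
  (forall n y, a < y < b -> `|g n y| <= M n) ->
  cvgn (series M) ->
  (forall y, a < y < b -> cvgn (series (f ^~ y))) ->
  is_derive x 1 (fun y => limn (series (f ^~ y))) (limn (series (g ^~ x))).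
Proof.
move=> /andP[ax xb] fg gM cM cf; apply: is_derive_quot.
have nearab : \forall h \near 0^', a < x + h < b.
  apply: cvg_within.
  have xx : (fun h : R => x + h) @ 0 --> x.
    by rewrite -[X in _ --> X]addr0; apply: cvgD; [exact: cvg_cst|exact: cvg_id].
  near=> h; apply/andP; split; near: h.
  - exact: cvgr_gt xx _ ax.
  - exact: cvgr_lt xx _ xb.
have H : (fun h => limn (series (fun n => (f n (x + h) - f n x) / h))) @ 0^' -->
    limn (series (g ^~ x)).
  apply: (@cvg_series_dominated _ _ _ _ _ M) => //.
  - by move=> n; apply: quot_is_derive; apply: fg; rewrite ax.
  - by move=> n; apply: gM; rewrite ax.
  near=> h => n.
  have h0 : h != 0 by near: h; exact: nbhs_dnbhs_neq.
  have /andP[axh xhb] : a < x + h < b by near: h.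
  rewrite normrM normrV ?unitfE// ler_pdivrMr ?normr_gt0//.
  (* The mean value inequality needs ordered end points, so the sign of [h] decides which of [x] and
     [x + h] comes first. *)
  have [hp|hn] := ltP 0 h.
    rewrite (gtr0_norm hp) {2}(_ : h = x + h - x); last lra.
    apply: mean_value_le; first lra.
    - move=> y /andP[? ?]; apply: fg; apply/andP; split; lra.
    - move=> y /andP[? ?]; apply: gM; apply/andP; split; lra.
  rewrite (ler0_norm hn) distrC (_ : - h = x - (x + h)); last lra.
  apply: mean_value_le; first lra.
  - move=> y /andP[? ?]; apply: fg; apply/andP; split; lra.
  - move=> y /andP[? ?]; apply: gM; apply/andP; split; lra.
apply: cvg_trans H; apply: near_eq_cvg; near=> h.
have xh : a < x + h < b by near: h.
have c1 := cf _ xh.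
have c2 : cvgn (series (f ^~ x)) by apply: cf; rewrite ax.
have -> : (fun n => (f n (x + h) - f n x) / h) =
   h^-1 *: ((f ^~ (x + h)) - (f ^~ x)).
  by apply/funext => n; rewrite /GRing.scale /= !fctE /GRing.scale/= mulrC.
rewrite lim_seriesZ; last exact: is_cvg_seriesB.
by rewrite lim_seriesB// mulrC.
Unshelve. all: by end_near. Qed.

Lemma ge0_series_bounded_cvg u (C : R) : (forall n, 0 <= u n) ->
  (forall n, series u n <= C) -> cvgn (series u).
Proof.
move=> u0 uC; apply: nondecreasing_is_cvgn.
  by apply/nondecreasing_seqP => n; rewrite seriesS lerDr.
by exists C => _ [n _ <-].
Qed.

Lemma series_inv_sqr_cvg : cvgn (series (fun n => n.+1%:R ^- 2 : R)).
Proof.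
apply: (@ge0_series_bounded_cvg _ 2) => [n|]; first by rewrite invr_ge0 sqr_ge0.
(* A telescoping majorant: 1/k - 1/(k+1) exceeds 1/(k+1)^2 by 1/(k (k+1)^2). *)
suff H n : series (fun n => n.+1%:R ^- 2 : R) n.+1 <= 2 - n.+1%:R^-1.
  case=> [|n]; first by rewrite /series /= big_geq.
  by apply: le_trans (H n) _; rewrite gerBl invr_ge0.
elim: n => [|n IH].
  by rewrite /series /= big_nat1 expr1n invr1; lra.
rewrite seriesS; apply: le_trans (lerD (lexx _) IH) _.
have k0 : 0 < n.+1%:R :> R by [].
rewrite -[in X in _ <= X]natr1 -[n.+2%:R]natr1.
move: (n.+1%:R) k0 => k k0.
have k1 : 0 < k + 1 by lra.
rewrite addrC -addrA lerD2l -subr_ge0.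
rewrite (_ : _ - _ = (k * (k + 1) ^+ 2)^-1); first by rewrite invr_ge0 mulr_ge0 ?sqr_ge0// ltW.
by field; rewrite !gt_eqF.
Qed.

Lemma limn_series_lin (c d : R) u v : cvgn (series u) -> cvgn (series v) ->
  cvgn (series (fun n => c * u n + d * v n)) /\
  limn (series (fun n => c * u n + d * v n)) =
    c * limn (series u) + d * limn (series v).
Proof.
move=> cu cv.
have E : series (fun n => c * u n + d * v n) =
    (fun n => c * series u n + d * series v n).
  by apply/funext => n; rewrite /series /= big_split /= -!mulr_sumr.
have H : (fun n => c * series u n + d * series v n) @ \oo -->
    c * limn (series u) + d * limn (series v).
  by apply: cvgD; apply: cvgM => //; exact: cvg_cst.
rewrite E; split; first by apply/cvg_ex; exists (c * limn (series u) + d * limn (series v)).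
exact/cvg_lim.
Qed.

Lemma within_continuous_series (T : topologicalType) (K : set T)
  (w : nat -> T -> R) M : (forall n, continuous (w n)) ->
  (forall n q, K q -> `|w n q| <= M n) -> cvgn (series M) ->
  {within K, continuous (fun q => limn (series (w ^~ q)))}.
Proof.
move=> cw wM cM; apply/subspace_continuousP => q Kq.
apply: (@cvg_series_dominated _ _ _ _ _ M) => //.
- by move=> n; apply: cvg_trans (cw n q); apply: cvg_app; exact: cvg_within.
- by move=> n; exact: wM.
- by rewrite near_withinE; apply: nearW => p Kp n; exact: wM.
Qed.

End Series.

(** * Integration on a closed interval with one-sided derivatives at its ends *)

Section IntervalIntegrals.
Variable R : realType.
Local Notation mu := (@lebesgue_measure R).
Implicit Types (a b c l m x : R) (f g F G : R -> R).

Lemma continuous_integrable a b f : {within `[a, b], continuous f} ->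
  mu.-integrable `[a, b] (EFin \o f).
Proof. by apply: continuous_compact_integrable; exact: segment_compact. Qed.

Lemma within_continuousM a b f g : {within `[a, b], continuous f} ->
  {within `[a, b], continuous g} ->
  {within `[a, b], continuous (fun x => f x * g x)}.
Proof. by move=> cf cg x; apply: cvgM; [exact: cf|exact: cg]. Qed.

Lemma within_continuous_ball a b f x e : {within `[a, b], continuous f} ->
  a <= x <= b -> 0 < e ->
  exists2 d, 0 < d &
    forall y, a <= y <= b -> `|x - y| < d -> `|f x - f y| < e.
Proof.
move=> /subspace_continuousP cf xab e0.
have /cvgrPdist_lt/(_ _ e0) := cf x (xab : `[a, b]%classic x).
rewrite near_withinE => /nbhs_ballP[d d0 H]; exists d => // y yab xy.
exact: H.
Qed.

Lemma within_continuous_reflect c f : {within `[- c, c], continuous f} ->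
  {within `[- c, c], continuous (fun x => f (- x))}.
Proof.
move=> cf; apply/subspace_continuousP => y yab.
have yab' : - c <= - y <= c.
  by move: yab; rewrite /= in_itv/= => /andP[? ?]; apply/andP; split; lra.
apply/cvgrPdist_lt => e e0.
have [d d0 Hd] := within_continuous_ball cf yab' e0.
rewrite near_withinE; apply/nbhs_ballP; exists d => // z yz zab; apply: Hd.
  by move: zab; rewrite /= in_itv/= => /andP[? ?]; apply/andP; split; lra.
by rewrite -normrN opprD !opprK.
Qed.

Lemma within_continuous_eq0 a b f x : a < b -> {within `[a, b], continuous f} ->
  (forall y, a < y < b -> f y = 0) -> a <= x <= b -> f x = 0.
Proof.
move=> ab cf f0 xab; apply/eqP; rewrite -normr_le0 leNgt; apply/negP => fx.
have [d d0 Hd] := within_continuous_ball cf xab fx.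
(* A shift from [x] towards the midpoint by at most a quarter of the length lands strictly inside
   the interval. *)
pose h := Num.min (d / 2) ((b - a) / 4).
have h0 : 0 < h by rewrite lt_min; apply/andP; split; lra.
have hd : h < d by rewrite gt_min; apply/orP; left; lra.
have hb : h <= (b - a) / 4 by rewrite ge_min lexx orbT.
have [y yab xy] : exists2 y, a < y < b & `|x - y| < d.
  case/andP: xab => ax xb; have [xm|xm] := leP x ((a + b) / 2).
    exists (x + h); first by apply/andP; split; lra.
    by rewrite opprD addNKr normrN gtr0_norm.
  exists (x - h); first by apply/andP; split; lra.
  by rewrite opprB addrC subrK gtr0_norm.
have yab' : a <= y <= b by case/andP: yab => ? ?; rewrite !ltW.
by have := Hd y yab' xy; rewrite (f0 y yab) subr0 ltxx.
Qed.

Lemma within_continuous_bound a b f : {within `[a, b], continuous f} ->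
  exists2 C, 0 < C & forall x, a <= x <= b -> `|f x| <= C.
Proof.
move=> cf.
have /compact_bounded[M [_ HM]] := continuous_compact cf (@segment_compact R a b).
exists (`|M| + 1) => [|x xab]; first by have := normr_ge0 M; lra.
apply: HM; first by have := ler_norm M; lra.
by exists x => //; rewrite /= in_itv.
Qed.

Lemma integrable_mul_continuous a b f g :
  mu.-integrable `[a, b] (EFin \o f) -> {within `[a, b], continuous g} ->
  mu.-integrable `[a, b] (EFin \o (fun x => f x * g x)).
Proof.
move=> intf cg.
have [C C0 gC] := within_continuous_bound cg.
have /measurable_EFinP mf := measurable_int _ intf.
have mg : measurable_fun `[a, b] g by exact: subspace_continuous_measurable_fun.
have intCf : mu.-integrable `[a, b] (EFin \o (fun x => C * `|f x|)).
  have : mu.-integrable `[a, b] (fun x => C%:E * (EFin \o (Num.Def.normr \o f)) x)%E.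
    by apply: integrableZl => //; exact: integrable_norm.
  by apply: eq_integrable => // x _; rewrite /= EFinM.
apply: le_integrable intCf => //.
  by apply/measurable_EFinP; exact: measurable_funM.
move=> x xab /=; rewrite lee_fin normrM (ger0_norm (_ : 0 <= C * _)); last first.
  by rewrite mulr_ge0// ltW.
by rewrite mulrC ler_wpM2r// gC.
Qed.

Lemma Rintegral_itv_oo_cc a b f : mu.-integrable `[a, b] (EFin \o f) ->
  \int[mu]_(x in `]a, b[) f x = \int[mu]_(x in `[a, b]) f x.
Proof.
move=> intf; rewrite -Rintegral_itv_obnd_cbnd; last first.
  apply: integrableS intf => //.
  by apply: subset_itv; rewrite bnd_simp.
rewrite -Rintegral_itv_bndo_bndc//.
apply: integrableS intf => //.
by apply: subset_itv; rewrite bnd_simp.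
Qed.

(** Convergence is asked only on the open interval, because the cutoffs used later tend to 1 inside
    but stay 0 at an end point. *)
Lemma Rintegral_cvg_dominated a b (f_ : nat -> R -> R) f G :
  (forall n, mu.-integrable `[a, b] (EFin \o f_ n)) ->
  mu.-integrable `[a, b] (EFin \o f) ->
  mu.-integrable `[a, b] (EFin \o G) ->
  (forall x, a < x < b -> (fun n => f_ n x) @ \oo --> f x) ->
  (forall n x, a <= x <= b -> `|f_ n x| <= G x) ->
  (fun n => \int[mu]_(x in `[a, b]) f_ n x) @ \oo -->
    \int[mu]_(x in `[a, b]) f x.
Proof.
move=> if_ iff iG ff fG.
have sub : (`]a, b[ : set R) `<=` `[a, b] by apply: subset_itv; rewrite bnd_simp.
under eq_fun do rewrite -Rintegral_itv_oo_cc//.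
rewrite -Rintegral_itv_oo_cc//.
apply: fine_cvg; rewrite fineK; last first.
  by apply: integrable_fin_num => //; exact: integrableS iff.
apply: (@dominated_cvg _ _ _ mu _ _ (fun n x => (f_ n x)%:E) _ (EFin \o G)) => //.
- move=> n; apply: (measurable_int mu); exact: integrableS (if_ n).
- move=> x xab; apply: cvg_EFin; first exact: nearW.
  by apply: ff; move: xab; rewrite /= in_itv.
- exact: integrableS iG.
- move=> n x xab; rewrite /= lee_fin; apply: fG.
  by have := sub _ xab; rewrite /= in_itv.
Qed.

Lemma Rintegral_reflect (c : R) f : 0 <= c -> {within `[- c, c], continuous f} ->
  \int[mu]_(x in `[- c, c]) f (- x) = \int[mu]_(x in `[- c, c]) f x.
Proof.
move=> c0 cf; rewrite /Rintegral; congr fine.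
have := @integration_by_substitution_oppr R f (- c) c.
rewrite opprK => -> //.
lra.
Qed.

Lemma deriv_within_continuous a b g l x : deriv_within a b g x l ->
  g @ within `[a, b] (nbhs x) --> g x.
Proof.
move=> H; apply/cvgrPdist_lt => e e0.
have /cvgrPdist_lt/(_ _ ltr01) := H.
rewrite !near_withinE => /nbhs_ballP[d d0 Hd].
(* Near [x] the quotient is at most |l| + 1 in modulus, so [g] satisfies a Lipschitz estimate at [x]
   with that constant. *)
have L0 : 0 < `|l| + 1 by have := normr_ge0 l; lra.
apply/nbhs_ballP; exists (Num.min d (e / (`|l| + 1))) => /=.
  by rewrite lt_min d0 divr_gt0.
move=> y; rewrite /ball/= lt_min => /andP[xyd xye] yab.
have [->|yx] := eqVneq y x; first by rewrite subrr normr0.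
have := Hd y xyd (conj yab yx).
have yx0 : y - x != 0 by rewrite subr_eq0.
rewrite distrC => q1.
rewrite distrC -(divfK yx0 (g y - g x)) normrM.
have qL : `|(g y - g x) / (y - x)| <= `|l| + 1.
  rewrite -[X in `|X|](subrK l).
  by apply: le_trans (ler_normD _ _) _; lra.
apply: le_lt_trans (_ : _ <= (`|l| + 1) * `|x - y|) _.
  by rewrite (distrC x) ler_wpM2r.
by rewrite mulrC -ltr_pdivlMr.
Qed.

Lemma is_derive_deriv_within a b g l x : is_derive x 1 g l ->
  deriv_within a b g x l.
Proof.
move=> /quot_is_derive H; rewrite /deriv_within.
have -> : (fun y => (g y - g x) / (y - x)) =
    (fun h => (g (x + h) - g x) / h) \o (fun y => y - x).
  by apply/funext => y /=; rewrite [x + _]addrC subrK.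
apply: cvg_comp H.
move=> A; rewrite /= => /nbhs_ballP[e e0 eA]; apply/nbhs_ballP; exists e => //.
move=> y xy [_ yx]; apply: eA; last by rewrite subr_eq0.
by move: xy; rewrite /ball/= sub0r normrN distrC.
Qed.

Lemma deriv_within_is_derive a b g l x : a < x < b ->
  deriv_within a b g x l -> is_derive x 1 g l.
Proof.
move=> /andP[ax xb] H; apply: is_derive_quot.
have -> : (fun h => (g (x + h) - g x) / h) =
    (fun y => (g y - g x) / (y - x)) \o (fun h => x + h).
  by apply/funext => y /=; rewrite (addrC x) addrK.
apply: cvg_comp H.
move=> A; rewrite /= => /nbhs_ballP[e e0 eA].
apply/nbhs_ballP; exists (Num.min e (Num.min (x - a) (b - x))) => /=.
  by rewrite !lt_min e0 !subr_gt0 ax xb.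
move=> h; rewrite /ball/= sub0r normrN !lt_min => /and3P[he ha hb] h0.
apply: eA; first by rewrite /ball/= opprD addNKr normrN.
move: ha hb; rewrite !ltr_norml => /andP[? ?] /andP[? ?].
split; last by rewrite /= -subr_eq0 [x + h]addrC addrK.
rewrite /= in_itv/=; apply/andP; split; lra.
Qed.

Lemma deriv_withinD a b f g x l m : deriv_within a b f x l ->
  deriv_within a b g x m -> deriv_within a b (fun y => f y + g y) x (l + m).
Proof.
move=> Hf Hg; rewrite /deriv_within.
have -> : (fun y => (f y + g y - (f x + g x)) / (y - x)) =
  (fun y => (f y - f x) / (y - x) + (g y - g x) / (y - x)).
  by apply/funext => y; rewrite opprD addrACA mulrDl.
exact: cvgD.
Qed.

Lemma deriv_within_within_continuous a b F f :
  (forall x, a <= x <= b -> deriv_within a b F x (f x)) ->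
  {within `[a, b], continuous F}.
Proof.
move=> FF; apply/subspace_continuousP => x; rewrite /= in_itv/= => xab.
exact: deriv_within_continuous (FF _ xab).
Qed.

(** Puts one-sided differentiability into the form that the fundamental theorem of calculus and
    integration by parts expect. *)
Lemma deriv_within_LRcontinuous a b F f : a < b ->
  (forall x, a <= x <= b -> deriv_within a b F x (f x)) ->
  derivable_oo_LRcontinuous F a b /\ {in `]a, b[, derive1 F =1 f}.
Proof.
move=> ab FF.
have := deriv_within_within_continuous FF.
move=> /(continuous_within_itvP _ ab)[_ Fa Fb].
have D x : x \in `]a, b[ -> is_derive x 1 F (f x).
  rewrite in_itv/= => /andP[ax xb].
  apply: (@deriv_within_is_derive a b); first by rewrite ax.
  by apply: FF; rewrite !ltW.
split; first by split => // x /D[].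
by move=> x /D[_ <-]; rewrite derive1E.
Qed.

Lemma Rintegral_deriv_within a b F f : a < b ->
  {within `[a, b], continuous f} ->
  (forall x, a <= x <= b -> deriv_within a b F x (f x)) ->
  \int[mu]_(x in `[a, b]) f x = F b - F a.
Proof.
move=> ab cf /(deriv_within_LRcontinuous ab)[LR D].
by rewrite /Rintegral (continuous_FTC2 ab cf LR D).
Qed.

Lemma Rintegral_by_parts_within a b F f G g : a < b ->
  {within `[a, b], continuous f} ->
  (forall x, a <= x <= b -> deriv_within a b F x (f x)) ->
  {within `[a, b], continuous g} ->
  (forall x, a <= x <= b -> deriv_within a b G x (g x)) ->
  \int[mu]_(x in `[a, b]) (F x * g x) =
  F b * G b - F a * G a - \int[mu]_(x in `[a, b]) (f x * G x).
Proof.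
move=> ab cf /(deriv_within_LRcontinuous ab)[LR D] cg.
move=> /(deriv_within_LRcontinuous ab)[LR' D'].
exact: Rintegration_by_parts.
Qed.

End IntervalIntegrals.

(** * Shifted cosines, their orthogonality and Bessel's inequality *)

Section Modes.
Variable R : realType.
Local Notation mu := (@lebesgue_measure R).
Implicit Types (a b th x : R) (f g : R -> R).

Definition intg a b f := mu.-integrable `[a, b] (EFin \o f).

Lemma intgD a b f g : intg a b f -> intg a b g -> intg a b (fun x => f x + g x).
Proof.
move=> If Ig.
have : mu.-integrable `[a, b] (fun x => (EFin \o f) x + (EFin \o g) x)%E.
  exact: integrableD.
by apply: eq_integrable => // x _; rewrite /= EFinD.
Qed.

Lemma intgZ a b f c : intg a b f -> intg a b (fun x => c * f x).
Proof.
move=> If.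
have : mu.-integrable `[a, b] (fun x => c%:E * (EFin \o f) x)%E.
  exact: integrableZl.
by apply: eq_integrable => // x _; rewrite /= EFinM.
Qed.

Lemma intgB a b f g : intg a b f -> intg a b g -> intg a b (fun x => f x - g x).
Proof.
move=> If Ig; have := intgD If (intgZ (-1) Ig).
by apply: eq_integrable => // x _ /=; rewrite mulN1r.
Qed.

Lemma continuous_intg a b f : continuous f -> intg a b f.
Proof.
by move=> cf; apply: continuous_integrable; exact: continuous_subspaceT.
Qed.

Lemma is_derive_continuous f x (l : R) : is_derive x 1 f l -> {for x, continuous f}.
Proof.
by move=> [d _]; apply: differentiable_continuous; exact/derivable1_diffP.
Qed.

(* [th = 0] gives [cos (k x)] and [th = pi / 2] gives [sin (k x)]. *)
Definition mode (k : nat) th x := cos (k%:R * x - th).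

Lemma is_derive_mode k th x :
  is_derive x 1 (mode k th) (- k%:R * mode k (th + pi / 2) x).
Proof.
have D : is_derive x 1 (fun y => k%:R * y - th) (k%:R : R).
  apply: is_derive_eq.
  by rewrite subr0 /GRing.scale /= mulr1.
have := @is_derive1_comp R cos (fun y => k%:R * y - th) x _ _ (is_derive_cos _) D.
move/is_derive_eq; apply.
by rewrite /mode opprD addrA cosBpihalf mulrC mulrN mulNr.
Qed.

Lemma continuous_mode k th : continuous (mode k th).
Proof. by move=> x; exact: is_derive_continuous (is_derive_mode k th x). Qed.

Lemma mode_le1 k th x : `|mode k th x| <= 1.
Proof. exact: cos_max. Qed.

Lemma mode0 th x : mode 0 th x = cos th.
Proof. by rewrite /mode mul0r sub0r cosN. Qed.

Lemma mode_cos k x : mode k 0 x = cos (k%:R * x).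
Proof. by rewrite /mode subr0. Qed.

Lemma mode_sin k x : mode k (pi / 2) x = sin (k%:R * x).
Proof. by rewrite /mode cosBpihalf. Qed.

Lemma modeE k th x : mode k th x = cos th * mode k 0 x + sin th * mode k (pi / 2) x.
Proof. by rewrite mode_cos mode_sin /mode cosB mulrC [sin _ * _]mulrC. Qed.

Lemma modeN k th x : mode k th (- x) = mode k (- th) x.
Proof. by rewrite /mode -cosN; congr cos; ring. Qed.

Lemma mode_oppth k th x : mode k (th + pi / 2 + pi / 2) x = - mode k th x.
Proof.
by rewrite /mode !opprD !addrA cosBpihalf -[LHS]opprK -[in LHS]cosDpihalf subrK.
Qed.

Lemma sin_natpi (k : nat) : sin (k%:R * pi) = 0 :> R.
Proof.
elim: k => [|k IH]; first by rewrite mul0r sin0.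
by rewrite -natr1 mulrDl mul1r sinD sinpi IH mul0r mulr0 addr0.
Qed.

Lemma mode_periodic k th : mode k th (- pi) = mode k th pi.
Proof. by rewrite modeN /mode opprK cosD cosB sin_natpi !mul0r subr0 addr0. Qed.

(** The order of [j] and [k] matters because [k - j] is a truncated subtraction. *)
Lemma mode_mul_le (j k : nat) th th' x : (j <= k)%N ->
  mode j th x * mode k th' x =
  2^-1 * (mode (k + j) (th' + th) x + mode (k - j) (th' - th) x).
Proof.
move=> jk; rewrite /mode natrD natrB//.
set A := k%:R * x - th'; set B := j%:R * x - th.
have -> : (k%:R + j%:R) * x - (th' + th) = A + B by rewrite /A /B; ring.
have -> : (k%:R - j%:R) * x - (th' - th) = A - B by rewrite /A /B; ring.
by rewrite (cosD A B) (cosB A B); field.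
Qed.

Lemma Rintegral_mode k th : (0 < k)%N -> \int[mu]_(x in `[- pi, pi]) mode k th x = 0.
Proof.
move=> k0.
have kn0 : k%:R != 0 :> R by rewrite pnatr_eq0 -lt0n.
rewrite (@Rintegral_deriv_within R _ _ (fun x => - k%:R^-1 * mode k (th - pi / 2) x)).
- by rewrite mode_periodic subrr.
- by have := pi_gt0 R; lra.
- exact/continuous_subspaceT/continuous_mode.
- move=> x _; apply: is_derive_deriv_within.
  have := is_deriveZ (- k%:R^-1) (is_derive_mode k (th - pi / 2) x).
  move/is_derive_eq; apply.
  by rewrite subrK /GRing.scale/= mulrA mulrNN mulVf// mul1r.
Qed.

Lemma Rintegral_cst_pi c : \int[mu]_(x in `[- pi, pi]) c = c * (2 * pi).
Proof.
rewrite Rintegral_cst//= lebesgue_measure_itv/= lte_fin.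
have -> : - pi < pi :> R by have := pi_gt0 R; lra.
by rewrite /=; ring.
Qed.

Lemma intgM_mode a b f k th : intg a b f -> intg a b (fun x => f x * mode k th x).
Proof.
move=> If; apply: integrable_mul_continuous => //.
exact/continuous_subspaceT/continuous_mode.
Qed.

Lemma intg_mode a b k th : intg a b (mode k th).
Proof. exact/continuous_intg/continuous_mode. Qed.

(** The case j = k = 0 is excluded: there the product is constant and integrates with the factor 2
    pi instead of pi. *)
Lemma Rintegral_mode_mul j k th th' : (0 < j)%N ->
  \int[mu]_(x in `[- pi, pi]) (mode j th x * mode k th' x) =
  (j == k)%:R * pi * cos (th - th').
Proof.
wlog jk : j k th th' / (j <= k)%N => [H|j0].
  have [jk|kj] := leqP j k; first exact: H.
  (* Exchanging the roles of [j] and [k] needs a positive [k]; for k = 0 the second mode is the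
     constant [cos th']. *)
  case: k kj => [|k] kj j0.
    under eq_Rintegral do rewrite mode0 mulrC.
    rewrite RintegralZl//; last exact: intg_mode.
    by rewrite Rintegral_mode// mulr0 gtn_eqF// !mul0r.
  rewrite eq_sym -cosN opprB -H ?(ltnW kj)//.
  by apply: eq_Rintegral => x _; rewrite mulrC.
under eq_Rintegral => x _ do rewrite (mode_mul_le _ _ _ jk).
rewrite RintegralZl//; last by apply: intgD; exact: intg_mode.
rewrite RintegralD//; try exact: intg_mode.
rewrite Rintegral_mode ?addn_gt0 ?j0 ?orbT// add0r.
have [->|jk'] := eqVneq j k.
  rewrite subnn; under eq_Rintegral => x _ do rewrite mode0.
  by rewrite Rintegral_cst_pi/= -[in RHS]cosN opprB; field.
by rewrite Rintegral_mode ?mulr0 ?mul0r// subn_gt0 ltn_neqAle jk' jk.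
Qed.

Lemma Rintegral_mode_mode j k th : (0 < j)%N ->
  \int[mu]_(x in `[- pi, pi]) (mode j th x * mode k th x) = (j == k)%:R * pi.
Proof. by move=> j0; rewrite Rintegral_mode_mul// subrr cos0 mulr1. Qed.

(** The factor 1/pi is kept for k = 0 as well, so the coefficient of index 0 is
    [2 * mean0 f * cos th], with the mean counted twice. *)
Definition fcoef f k th := pi^-1 * \int[mu]_(x in `[- pi, pi]) (f x * mode k th x).

Lemma bessel f th n : intg (- pi) pi f -> intg (- pi) pi (fun x => f x ^+ 2) ->
  \sum_(k < n) fcoef f k.+1 th ^+ 2 <=
  pi^-1 * \int[mu]_(x in `[- pi, pi]) (f x ^+ 2).
Proof.
move=> If If2; have pi0 : pi != 0 :> R by rewrite gt_eqF// pi_gt0.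
(* [r] is what remains of [f] after the first [n] modes are projected out. Its square integral is
   nonnegative, and its coefficients beyond [n] are still those of [f], which lets the induction
   remove the next mode. *)
suff [r [_ _ Er _]] : exists r, [/\ intg (- pi) pi r,
    intg (- pi) pi (fun x => r x ^+ 2),
    \int[mu]_(x in `[- pi, pi]) (r x ^+ 2) =
      \int[mu]_(x in `[- pi, pi]) (f x ^+ 2)
      - pi * \sum_(k < n) fcoef f k.+1 th ^+ 2 &
    forall m, (n < m)%N -> fcoef r m th = fcoef f m th].
  have : 0 <= \int[mu]_(x in `[- pi, pi]) (r x ^+ 2).
    by apply: Rintegral_ge0 => x _; exact: sqr_ge0.
  by rewrite Er subr_ge0 mulrC -ler_pdivlMr ?pi_gt0// mulrC.
elim: n => [|n [r [Ir Ir2 Er rf]]].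
  by exists f; split => //; rewrite big_ord0 mulr0 subr0.
pose c := fcoef f n.+1 th.
have Irc m := intgM_mode m th Ir.
have Icc m : intg (- pi) pi (fun x => mode m th x * mode n.+1 th x).
  exact/intgM_mode/intg_mode.
have Ecoef m : \int[mu]_(x in `[- pi, pi]) (r x * mode m th x) = pi * fcoef r m th.
  by rewrite /fcoef mulrA mulfV// mul1r.
exists (fun x => r x - c * mode n.+1 th x); split.
- by apply: intgB => //; apply: intgZ; exact: intg_mode.
- have : intg (- pi) pi (fun x => (r x ^+ 2 - 2 * c * (r x * mode n.+1 th x))
    + c ^+ 2 * (mode n.+1 th x * mode n.+1 th x)).
    by apply: intgD; [apply: intgB => //|]; apply: intgZ.
  by apply: eq_integrable => // x _ /=; congr EFin; ring.
- rewrite (_ : \int[mu]_(x in `[- pi, pi]) _ = \int[mu]_(x in `[- pi, pi])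
    ((r x ^+ 2 - 2 * c * (r x * mode n.+1 th x))
    + c ^+ 2 * (mode n.+1 th x * mode n.+1 th x))); last first.
    by apply: eq_Rintegral => x _; ring.
  have I1 := intgZ (2 * c) (Irc n.+1).
  have I2 := intgZ (c ^+ 2) (Icc n.+1).
  rewrite RintegralD//; last exact: intgB.
  rewrite RintegralB// Er.
  rewrite (RintegralZl (2 * c) _ (Irc _))//.
  rewrite (RintegralZl (c ^+ 2) _ (Icc _))//.
  rewrite Rintegral_mode_mode// eqxx Ecoef rf// -/c big_ord_recr /= -/c; ring.
- move=> m nm; rewrite /fcoef.
  under eq_Rintegral => x _ do rewrite mulrBl -mulrA [_ * mode m th x]mulrC.
  have I1 : intg (- pi) pi (fun x => mode m th x * r x).
    by apply: eq_integrable (Irc m) => // x _; rewrite /= mulrC.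
  rewrite RintegralB//; last first.
    apply: intgZ; apply: eq_integrable (Icc m) => // x _.
    by rewrite /= mulrC.
  under eq_Rintegral => x _ do rewrite mulrC.
  rewrite RintegralZl//; last first.
    by apply: eq_integrable (Icc m) => // x _; rewrite /= mulrC.
  rewrite [X in _ - _ * X](_ : _ = 0); last first.
    by rewrite Rintegral_mode_mode// ltn_eqF// mul0r.
  rewrite mulr0 subr0.
  by rewrite -/(fcoef r m th) rf// ltnW.
Qed.

End Modes.

(** * A continuous function with vanishing Fourier coefficients is zero *)

Section FourierUniqueness.
Variable R : realType.
Local Notation mu := (@lebesgue_measure R).
Implicit Types (a b c d th x : R) (f g q : R -> R).

Lemma Rintegral_ge_sub a b c d (K : R) f : a <= c -> c <= d -> d <= b -> 0 <= K ->
  intg a b f -> (forall x, a <= x <= b -> 0 <= f x) ->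
  (forall x, c <= x <= d -> K <= f x) ->
  K * (d - c) <= \int[mu]_(x in `[a, b]) f x.
Proof.
move=> ac cd db K0 If f0 fK.
have sub : (`[c, d] : set R) `<=` `[a, b].
  by apply: subset_itv; rewrite bnd_simp.
have mf := measurable_int _ If.
have If' : intg c d f by apply: integrableS If.
apply: (@le_trans _ _ (\int[mu]_(x in `[c, d]) f x)).
  have <- : \int[mu]_(x in `[c, d]) K = K * (d - c).
    rewrite Rintegral_cst//= lebesgue_measure_itv/= lte_fin.
    case: ltP => // dc; have -> : d = c by apply/eqP; rewrite eq_le dc cd.
    by rewrite subrr.
  apply: le_Rintegral => //.
    by apply: continuous_intg => x; exact: cvg_cst.
rewrite /Rintegral fine_le//; [exact: integrable_fin_num..|].
by apply: ge0_subset_integral => // x; rewrite /= in_itv/= => xab; rewrite lee_fin f0.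
Qed.

Lemma bernoulli_le (w : R) n : 0 <= w -> 1 + n%:R * w <= (1 + w) ^+ n.
Proof.
move=> w0; elim: n => [|n IH]; first by rewrite mul0r addr0 expr0.
have nw : 0 <= n%:R * w * w by rewrite !mulr_ge0// ler0n.
rewrite exprS -natr1; apply: le_trans (_ : _ <= (1 + w) * (1 + n%:R * w)) _.
  by rewrite mulrDl mul1r mulrDr mulr1 mulrDl mul1r mulrA (mulrC w); lra.
by rewrite ler_wpM2l//; lra.
Qed.

Lemma continuous_cos_sub (x0 : R) : continuous (fun x => cos (x - x0)).
Proof.
move=> x; apply: continuous_comp; last exact: continuous_cos.
by apply: cvgB; [exact: cvg_id|exact: cvg_cst].
Qed.

(** The upper bound on |y| keeps [y] at distance [r] from the next maxima of the cosine, at 2 pi and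
    -2 pi. *)
Lemma cos_le_cos_away (r y : R) : 0 < r -> r <= `|y| -> `|y| <= 2 * pi - r ->
  cos y <= cos r.
Proof.
move=> r0 ry y2; have pi0 := pi_gt0 R.
have -> : cos y = cos `|y| by case: (ger0P y) => // _; rewrite cosN.
have le_cos u : r <= u <= pi -> cos u <= cos r.
  move=> /andP[ru upi]; rewrite leNgt ltr_cos ?in_itv/=; first by rewrite -leNgt.
  - by apply/andP; split; lra.
  - by apply/andP; split; lra.
have [ypi|piy] := leP `|y| pi; first by apply: le_cos; rewrite ry.
rewrite -cosN (_ : - `|y| = 2 * pi - `|y| - pi *+ 2); last by ring.
rewrite -(cosD2pi (_ - _ - _)) subrK.
by apply: le_cos; apply/andP; split; lra.
Qed.

Section Null.
Variable g : R -> R.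
Hypothesis cg : {within `[- pi, pi], continuous g}.
Hypothesis g0 : forall k th, \int[mu]_(x in `[- pi, pi]) (g x * mode k th x) = 0.

(** The multipliers [q] for which [g q] is still orthogonal to every mode. They contain 1 and are
    stable under multiplication by the kernel, hence contain all its powers. *)
Let null q := continuous q /\
  forall k th, \int[mu]_(x in `[- pi, pi]) (g x * q x * mode k th x) = 0.

Let intg_null q k th : continuous q ->
  intg (- pi) pi (fun x => g x * q x * mode k th x).
Proof.
move=> cq; apply: intgM_mode; apply: integrable_mul_continuous.
  exact: continuous_integrable.
exact: continuous_subspaceT.
Qed.

Lemma null_mul_cos q (C x0 : R) : null q -> null (fun x => q x * (C + cos (x - x0))).
Proof.
move=> [cq nq]; split=> [x|k th].
  apply: cvgM; first exact: cq.
  apply: cvgD; first exact: cvg_cst.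
  exact: continuous_cos_sub.
have E x : g x * (q x * (C + cos (x - x0))) * mode k th x =
    C * (g x * q x * mode k th x) +
    2^-1 * (g x * q x * mode k.+1 (th + x0) x +
            (* Product-to-sum yields the frequencies k + 1 and k - 1; for k = 0 the latter is -1,
               and the evenness of the cosine turns it into frequency 1 with the opposite phase. *)
            g x * q x * (if k is k'.+1 then mode k' (th - x0) x
                         else mode 1 (x0 - th) x)).
  have -> : cos (x - x0) = mode 1 x0 x by rewrite /mode mul1r.
  case: k => [|k].
    have := @mode_mul_le R 0 1 th x0 x (leq0n _); rewrite addn0 subn0 [x0 + _]addrC.
    move=> E; transitivity (C * (g x * q x * mode 0 th x) +
      g x * q x * (mode 0 th x * mode 1 x0 x)); first by ring.
    by rewrite E; ring.
  have := @mode_mul_le R 1 k.+1 x0 th x (ltn0Sn k); rewrite addn1 subn1 /=.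
  move=> E; transitivity (C * (g x * q x * mode k.+1 th x) +
    g x * q x * (mode 1 x0 x * mode k.+1 th x)); first by ring.
  by rewrite E; ring.
under eq_Rintegral do rewrite E.
have I1 := intg_null k th cq.
have I2 := intg_null k.+1 (th + x0) cq.
case: k {E} I1 I2 => [|k] I1 I2.
  have I3 := intg_null 1 (x0 - th) cq.
  rewrite RintegralD//; [|exact: intgZ|by apply: intgZ; exact: intgD].
  rewrite !RintegralZl//; last exact: intgD.
  by rewrite RintegralD// !nq addr0 !mulr0 addr0.
have I3 := intg_null k (th - x0) cq.
rewrite RintegralD//; [|exact: intgZ|by apply: intgZ; exact: intgD].
rewrite !RintegralZl//; last exact: intgD.
by rewrite RintegralD// !nq addr0 !mulr0 addr0.
Qed.

Lemma null_kernel (C x0 : R) n :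
  \int[mu]_(x in `[- pi, pi]) (g x * (C + cos (x - x0)) ^+ n) = 0.
Proof.
have [cq nq] : null (fun x => (C + cos (x - x0)) ^+ n).
  elim: n => [|n IH].
    split=> [x|k th]; first by under eq_fun do rewrite expr0; exact: cvg_cst.
    by under eq_Rintegral do rewrite expr0 mulr1.
  rewrite (_ : (fun x => _) =
    fun x => (C + cos (x - x0)) ^+ n * (C + cos (x - x0))); last first.
    by apply/funext => x; rewrite exprSr.
  exact: null_mul_cos.
rewrite -[RHS](nq 0%N 0); apply: eq_Rintegral => x _.
by rewrite mode0 cos0 mulr1.
Qed.

(* The kernel [1 + cos (x - x0) - cos r] exceeds [1] near [x0] and has modulus at
   most [1] elsewhere on the period, so its powers would make the integral blow up. *)
Lemma fourier_unique_le x0 : - pi < x0 < pi -> g x0 <= 0.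
Proof.
move=> /andP[ax xb]; rewrite leNgt; apply/negP => gx0.
have pi0 := pi_gt0 R.
have [M M0 gM] := within_continuous_bound cg.
have [||d d0 gd] := @within_continuous_ball R (- pi) pi g x0 (g x0 / 2) cg.
- by rewrite !ltW.
- by rewrite divr_gt0.
pose m := g x0 / 2; have m0 : 0 < m by rewrite divr_gt0.
(* [r] is below the radius on which [g] stays above [m]; being at most the distance from [x0] to
   both ends, it also keeps [x - x0] away from 2 pi and -2 pi. *)
pose r := Num.min (d / 2) (Num.min (x0 + pi) (pi - x0)).
have [r0 rd ra rb] : [/\ 0 < r, r < d, r <= x0 + pi & r <= pi - x0].
  rewrite /r; split.
  - by rewrite !lt_min; apply/and3P; split; lra.
  - by rewrite gt_min; apply/orP; left; lra.
  - by rewrite !ge_min lexx orbT.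
  - by rewrite !ge_min lexx !orbT.
have rpi : r <= pi by lra.
have gm x : `|x - x0| <= r -> m <= g x.
  move=> xr; have : `|g x0 - g x| < g x0 / 2.
    move: (xr); rewrite ler_norml => /andP[? ?].
    apply: gd; first by apply/andP; split; lra.
    by rewrite distrC; lra.
  by rewrite ltr_norml /m => /andP[? ?]; lra.
pose w x := (cos (x - x0) - cos r + `|cos (x - x0) - cos r|) / 2.
pose C := 1 - cos r.
have cosr : cos r <= 1 := cos_le1 r.
(* [w] is the positive part of cos (x - x0) - cos r. Bernoulli's inequality makes the lower bound
   linear in [n], which is enough to contradict the vanishing integral by the Archimedean
   property. *)
have key n x : - pi <= x <= pi ->
    m * n%:R * w x - M <= g x * (C + cos (x - x0)) ^+ n.
  move=> xab; have := gM _ xab; have Nr := ler_norml.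
  have [xr|xr] := leP `|x - x0| r.
    have gmx := gm _ xr => _.
    have c0 : 0 <= cos (x - x0) - cos r.
      have -> : cos (x - x0) = cos `|x - x0| by case: (ger0P (x - x0)) => // _; rewrite cosN.
      rewrite subr_ge0 leNgt ltr_cos ?in_itv/=; first by rewrite -leNgt.
      - by apply/andP; split; lra.
      - by apply/andP; split => //; lra.
    have -> : w x = cos (x - x0) - cos r by rewrite /w ger0_norm//; field.
    have -> : C + cos (x - x0) = 1 + (cos (x - x0) - cos r) by rewrite /C; ring.
    move: (cos (x - x0) - cos r) c0 => y y0.
    have B := bernoulli_le n y0.
    apply: le_trans (_ : _ <= m * (1 + y) ^+ n) _; last first.
      by rewrite ler_wpM2r// exprn_ge0//; lra.
    apply: le_trans (_ : _ <= m * (1 + n%:R * y)) _.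
      by rewrite mulrDr mulr1 mulrA; lra.
    by rewrite ler_pM2l.
  move=> gMx.
  have cle : cos (x - x0) <= cos r.
    apply: cos_le_cos_away => //; first exact: ltW.
    by case/andP: xab => ? ?; rewrite ler_norml; apply/andP; split; lra.
  have -> : w x = 0 by rewrite /w ler0_norm ?subr_le0// subrr mul0r.
  have : `|g x * (C + cos (x - x0)) ^+ n| <= M.
    rewrite normrM normrX -[leRHS]mulr1.
    apply: ler_pM => //; rewrite ?exprn_ge0//.
    apply: exprn_ile1 => //.
    have := cos_geN1 (x - x0).
    by rewrite /C ler_norml => ?; apply/andP; split; lra.
  by rewrite ler_norml => /andP[? _]; lra.
have cw : continuous w.
  have cy : continuous (fun x => cos (x - x0) - cos r).
    by move=> x; apply: cvgB; [exact: continuous_cos_sub|exact: cvg_cst].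
  move=> x; apply: cvgM; last exact: cvg_cst.
  by apply: cvgD; [exact: cy|apply: cvg_norm; exact: cy].
have Iw := @continuous_intg R (- pi) pi _ cw.
pose W := \int[mu]_(x in `[- pi, pi]) w x.
have W0 : 0 < W.
  have cr2 : 0 < cos (r / 2) - cos r.
    by rewrite subr_gt0 ltr_cos ?in_itv/=; try (apply/andP; split); lra.
  apply: lt_le_trans (_ : 0 < (cos (r / 2) - cos r) * (x0 + r / 2 - (x0 - r / 2))) _.
    by rewrite mulr_gt0//; lra.
  apply: Rintegral_ge_sub => //; try lra.
    by move=> x _; rewrite /w; have := ler_norm (- (cos (x - x0) - cos r)); rewrite normrN; lra.
  move=> x /andP[? ?].
  apply: le_trans (_ : _ <= cos (x - x0) - cos r) _; last first.
    by rewrite /w; have := ler_norm (cos (x - x0) - cos r); lra.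
  rewrite lerB//.
  have -> : cos (x - x0) = cos `|x - x0| by case: (ger0P (x - x0)) => // _; rewrite cosN.
  have xr2 : `|x - x0| <= r / 2 by rewrite ler_norml; apply/andP; split; lra.
  rewrite leNgt ltr_cos ?in_itv/=; first by rewrite -leNgt.
  - by apply/andP; split; lra.
  - by apply/andP; split => //; lra.
have main n : m * n%:R * W - M * (2 * pi) <= 0.
  rewrite -(null_kernel C x0 n) -Rintegral_cst_pi /W -RintegralZl//.
  have IM : intg (- pi) pi (fun=> M) by apply: continuous_intg => x; exact: cvg_cst.
  rewrite -RintegralB//; last exact: intgZ.
  apply: le_Rintegral => //.
  - by apply: intgB => //; exact: intgZ.
  - apply: integrable_mul_continuous; first exact: continuous_integrable.
    apply: continuous_subspaceT => x.
    apply: (@continuous_comp _ _ _ (fun x => C + cos (x - x0)) (fun y => y ^+ n)).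
      apply: cvgD; first exact: cvg_cst.
      exact: continuous_cos_sub.
    exact: exprn_continuous.
  - by move=> x; rewrite /= in_itv/=; exact: key.
have mW : 0 < m * W by rewrite mulr_gt0.
have := archi_boundP (_ : 0 <= M * (2 * pi) / (m * W)).
move=> /(_ _)/wrap[]; first by rewrite divr_ge0 ?ltW// mulr_gt0//; lra.
set n := Num.bound _; rewrite ltr_pdivrMr// => H.
have := main n; rewrite subr_le0 leNgt => /negP; apply.
by rewrite (_ : m * n%:R * W = n%:R * (m * W))//; ring.
Qed.

End Null.

(** The one-sided estimate is applied to [g] and to its opposite inside the interval; continuity
    then covers the end points. *)
Lemma fourier_unique g : {within `[- pi, pi], continuous g} ->
  (forall k th, fcoef g k th = 0) -> forall x, - pi <= x <= pi -> g x = 0.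
Proof.
move=> cg g0; have pi0 := pi_gt0 R.
have piV : pi^-1 != 0 :> R by rewrite invr_eq0 gt_eqF.
have g0' k th : \int[mu]_(x in `[- pi, pi]) (g x * mode k th x) = 0.
  by have /eqP := g0 k th; rewrite mulf_eq0 (negbTE piV) => /eqP.
have cNg : {within `[- pi, pi], continuous (fun x => - g x)}.
  by move=> x; apply: cvgN; exact: cg.
have Ng0 k th : \int[mu]_(x in `[- pi, pi]) (- g x * mode k th x) = 0.
  under eq_Rintegral do rewrite -mulN1r -mulrA.
  rewrite RintegralZl// ?g0' ?mulr0//.
  by apply: intgM_mode; exact: continuous_integrable.
have gin x : - pi < x < pi -> g x = 0.
  move=> xab; apply/eqP; rewrite eq_le (fourier_unique_le cg g0' xab)/=.
  by have := fourier_unique_le cNg Ng0 xab; rewrite oppr_le0.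
by move=> x; apply: within_continuous_eq0 => //; lra.
Qed.

End FourierUniqueness.

(** * Fourier coefficients of a weak derivative *)

Section WeakDerivative.
Variable R : realType.
Local Notation mu := (@lebesgue_measure R).
Implicit Types (a b c th x y z : R) (f g : R -> R) (p : {poly R}).

(** Each monomial obeys y^i <= i! exp y, a single term of the exponential series. *)
Lemma poly_expR_bound p : exists2 C, 0 < C & forall y, 0 <= y -> `|p.[y]| <= C * expR y.
Proof.
exists (1 + \sum_(i < size p) `|p`_i| * (i`!)%:R) => [|y y0].
  by rewrite ltr_pwDl// sumr_ge0.
rewrite horner_coef mulrDl mul1r.
apply: le_trans (ler_norm_sum _ _ _) _.
rewrite -[leLHS]add0r lerD ?expR_ge0// mulr_suml; apply: ler_sum => i _.
rewrite normrM (ger0_norm (exprn_ge0 _ y0)) -mulrA ler_wpM2l//.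
rewrite -ler_pdivrMl ?ltr0n ?fact_gt0// mulrC.
case: (nat_of_ord i) => [|n].
  by rewrite expr0 fact0 invr1 mulr1; have := expR_ge1Dx y; lra.
by have := expR_ge1Dxn n y0; lra.
Qed.

(* [flat p] extends [p (1/z) exp (-1/z)] by zero to the left of the origin; such
   functions are closed under differentiation. *)
Definition flat p z := if 0 < z then p.[z^-1] * expR (- z^-1) else 0.

Lemma flat_pos p z : 0 < z -> flat p z = p.[z^-1] * expR (- z^-1).
Proof. by rewrite /flat => ->. Qed.

Lemma flat_npos p z : z <= 0 -> flat p z = 0.
Proof. by rewrite /flat leNgt => /negbTE ->. Qed.

(** For z > 0, differentiating p(1/z) exp (-1/z) gives the factor 1/z^2 times (p - p')(1/z), whence
    the new polynomial. *)
Lemma is_derive_flat p z : is_derive z 1 (flat p) (flat ('X^2 * (p - p^`())) z).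
Proof.
have [z0|z0|->] := ltrgtP z 0.
- rewrite flat_npos; last exact: ltW.
  apply: (@near_eq_is_derive _ _ _ (cst 0)).
  near=> y; rewrite flat_npos//; apply: ltW; near: y; exact: lt_nbhsl.
- rewrite flat_pos//.
  apply: (@near_eq_is_derive _ _ _ (fun z => p.[z^-1] * expR (- z^-1))).
    near=> y; rewrite flat_pos//; near: y; exact: lt_nbhsr.
  have zn0 : z != 0 by rewrite gt_eqF.
  have D1 : is_derive z 1 (fun z => z^-1) (- z ^- 2).
    have := is_deriveV zn0 (is_derive_id z (1 : R)).
    by move/is_derive_eq; apply; rewrite /GRing.scale/= mulr1.
  have D2 := @is_derive1_comp R (horner p) (fun z => z^-1) z _ _ (is_derive_poly p _) D1.
  have D3 := @is_derive1_comp R expR (fun z => - z^-1) z _ _ (is_derive_expR _) (is_deriveN D1).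
  have := is_deriveM D2 D3.
  move/is_derive_eq; apply.
  rewrite /GRing.scale/= hornerM hornerXn hornerD hornerN exprVn; ring.
- rewrite flat_npos//; apply: is_derive_quot.
  rewrite (flat_npos _ (lexx 0)).
  (* The quotient at 0 is p(1/h) exp (-1/h) / h. Bounding X^2 p instead of X p leaves a spare factor
     [h], so the quotient is at most C h. *)
  have [C C0 HC] := poly_expR_bound ('X^2 * p).
  apply/cvgrPdist_le => e e0.
  near=> h; rewrite sub0r normrN add0r subr0.
  have [h0|h0] := ltP 0 h; last by rewrite flat_npos// mul0r normr0 ltW.
  rewrite flat_pos//.
  have hn0 : h != 0 by rewrite gt_eqF.
  have := HC h^-1; rewrite invr_ge0 (ltW h0) => /(_ isT).
  rewrite hornerM hornerXn => HC'.
  have -> : p.[h^-1] * expR (- h^-1) / h =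
     (h^-1 ^+ 2 * p.[h^-1]) * expR (- h^-1) * h by field.
  rewrite normrM (gtr0_norm h0) normrM (gtr0_norm (expR_gt0 _)).
  apply: le_trans (_ : _ <= C * h) _.
    rewrite ler_pM2r// expRN ler_pdivrMr ?expR_gt0//.
  rewrite mulrC -ler_pdivlMr//; apply: le_trans (ler_norm _) _.
  by near: h; apply: dnbhs0_le; rewrite divr_gt0.
Unshelve. all: by end_near. Qed.

(** A class of expressions closed under differentiation. All iterated derivatives of a test function
    then exist by induction, with no formula for them. *)
Inductive smooth : (R -> R) -> Prop :=
| smooth_cst c : smooth (fun=> c)
| smooth_mode k th : smooth (mode k th)
| smooth_flat p a b : smooth (fun x => flat p (a * x + b))
| smoothD f g : smooth f -> smooth g -> smooth (fun x => f x + g x)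
| smoothM f g : smooth f -> smooth g -> smooth (fun x => f x * g x).

Lemma is_derive_flat_affine p a b x :
  is_derive x 1 (fun x => flat p (a * x + b)) (flat ('X^2 * (p - p^`())) (a * x + b) * a).
Proof.
have D : is_derive x 1 (fun y => a * y + b) a.
  apply: is_derive_eq.
  by rewrite addr0 /GRing.scale /= mulr1.
exact: (@is_derive1_comp R (flat p) (fun x => a * x + b) x _ _ (is_derive_flat _ _) D).
Qed.

Lemma smooth_is_derive f : smooth f ->
  exists2 f', smooth f' & forall x, is_derive x 1 f (f' x).
Proof.
elim=> {f} [c|k th|p a b|f g sf [f' sf' Df] sg [g' sg' Dg]|f g sf [f' sf' Df] sg [g' sg' Dg]].
- by exists (fun=> 0); [exact: smooth_cst|move=> x; exact: is_derive_cst].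
- exists (fun x => - k%:R * mode k (th + pi / 2) x); last exact: is_derive_mode.
  by apply: smoothM; [exact: smooth_cst|exact: smooth_mode].
- exists (fun x => flat ('X^2 * (p - p^`())) (a * x + b) * a).
    by apply: smoothM; [exact: smooth_flat|exact: smooth_cst].
  exact: is_derive_flat_affine.
- exists (fun x => f' x + g' x); first exact: smoothD.
  by move=> x; exact: is_deriveD.
- exists (fun x => f x * g' x + g x * f' x); first by apply: smoothD; exact: smoothM.
  by move=> x; exact: is_deriveM.
Qed.

Lemma smooth_derivable f n x : smooth f -> derivable (iter n (@derive1 R R) f) x 1.
Proof.
move=> sf; suff /smooth_is_derive[f' _ D] : smooth (iter n (@derive1 R R) f).
  by have [] := D x.
elim: n => // n /smooth_is_derive[f' sf' D] /=.
rewrite (_ : derive1 _ = f')//; apply/funext => y.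
by have [_ <-] := D y; rewrite derive1E.
Qed.

(** On a bounded interval square integrability gives integrability, since |y| <= 1 + y^2. *)
Lemma weak_deriv_intg a b g2 g3 : weak_deriv_L2 a b g2 g3 ->
  intg a b g3 /\ intg a b (fun x => g3 x ^+ 2).
Proof.
move=> [mg [ig _]]; split=> //.
have I1 : intg a b (fun x => 1 + g3 x ^+ 2).
  by apply: intgD => //; apply: continuous_intg => x; exact: cvg_cst.
apply: le_integrable I1 => //; first exact/measurable_EFinP.
move=> x _ /=; rewrite lee_fin [leRHS]ger0_norm; last first.
  by rewrite addr_ge0// sqr_ge0.
have := sqr_ge0 (`|g3 x| - 1); have := normr_ge0 (g3 x).
by rewrite -(real_normK (num_real (g3 x))) => ? ?; nra.
Qed.

Lemma flat1_itv z : 0 <= flat 1 z <= 1.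
Proof.
have [z0|z0] := ltP 0 z; last by rewrite flat_npos// lexx ler01.
by rewrite flat_pos// hornerC mul1r expR_ge0/= -expR0 ler_expR lerNl oppr0 invr_ge0 ltW.
Qed.

(** For t > 2, exp (-1/(t-1)) >= 1 - 1/(t-1) >= 1 - 2/t. With t = (n+1)(x + pi) this is the rate at
    which the cutoffs tend to 1. *)
Lemma flat1_lim t : 0 < t -> 1 - 2 / t <= flat 1 (t - 1).
Proof.
move=> t0; have [t2|t2] := leP t 2.
  apply: le_trans (_ : _ <= 0) _; last by have /andP[] := flat1_itv (t - 1).
  by rewrite subr_le0 ler_pdivlMr// mul1r.
rewrite flat_pos ?hornerC ?mul1r; last lra.
apply: le_trans (expR_ge1Dx _); rewrite lerD2l lerN2.
rewrite -[leLHS]mul1r ler_pdivrMr; last lra.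
by rewrite mulrAC ler_pdivlMr// mul1r; lra.
Qed.

Lemma flatX2_ge0 z : 0 <= flat 'X^2 z.
Proof.
have [z0|z0] := ltP 0 z; last by rewrite flat_npos.
by rewrite flat_pos// hornerXn mulr_ge0// ?expR_ge0// exprn_ge0// invr_ge0 ltW.
Qed.

(** With t = (n+1)(x + pi) the quantity is (x + pi) times the derivative of the cutoff. The constant
    3 serves as dominating function, and the decay 6/t gives pointwise convergence to 0. *)
Lemma flatX2_bound t : t * flat 'X^2 (t - 1) <= 3 /\
  (0 < t -> t * flat 'X^2 (t - 1) <= 6 / t).
Proof.
have [t1|t1] := ltP 1 t; last first.
  rewrite flat_npos ?mulr0; last lra.
  by split=> // t0; rewrite divr_ge0// ltW.
rewrite flat_pos ?hornerXn; last lra.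
pose w := (t - 1)^-1.
have w0 : 0 < w by rewrite invr_gt0; lra.
have tw : t = 1 + w^-1 by rewrite invrK; lra.
have E : t * ((t - 1)^-1 ^+ 2 * expR (- (t - 1)^-1)) = (w + w ^+ 2) / expR w.
  rewrite -/w expRN {1}tw; field.
  by rewrite !gt_eqF// expR_gt0.
rewrite E.
have e1 := expR_ge1Dx w.
have e2 : 1 + w ^+ 2 / 2 <= expR w by have := expR_ge1Dxn 1 (ltW w0).
(* Adding [e1] to twice [e2] gives 3 exp w >= 3 + w + w^2. *)
have B3 : (w + w ^+ 2) / expR w <= 3 by rewrite ler_pdivrMr ?expR_gt0//; lra.
split=> // t0; have [t2|t2] := leP t 2.
  by apply: le_trans B3 _; rewrite ler_pdivlMr//; lra.
apply: le_trans (_ : _ <= w + w ^+ 2) _.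
  rewrite ler_pdivrMr ?expR_gt0// ler_peMr//; last lra.
  by rewrite addr_ge0// ?sqr_ge0// ltW.
have w1 : w <= 1 by rewrite invf_le1; lra.
apply: le_trans (_ : _ <= 2 * w) _; first by nra.
by rewrite ler_pdivlMr// tw mulrDr mulr1 mulfK ?gt_eqF//; lra.
Qed.

Let cutoff n x := flat 1 (n.+1%:R * x + (n.+1%:R * pi - 1)).
Let cutoff' n x := flat 'X^2 (n.+1%:R * x + (n.+1%:R * pi - 1)) * n.+1%:R.

Lemma is_derive_cutoff n x : is_derive x 1 (cutoff n) (cutoff' n x).
Proof.
have := is_derive_flat_affine 1 n.+1%:R (n.+1%:R * pi - 1) x.
by rewrite derivC subr0 mulr1.
Qed.

Lemma cutoff_argE n x : n.+1%:R * x + (n.+1%:R * pi - 1) = n.+1%:R * (x + pi) - 1.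
Proof. by rewrite addrA -mulrDr. Qed.

Lemma cutoff_itv n x : 0 <= cutoff n x <= 1.
Proof. exact: flat1_itv. Qed.

Lemma cutoff'_ge0 n x : 0 <= cutoff' n x.
Proof. by rewrite mulr_ge0// flatX2_ge0. Qed.

Lemma continuous_cutoff' n : continuous (cutoff' n).
Proof.
move=> x; apply: cvgM; last exact: cvg_cst.
exact: is_derive_continuous (is_derive_flat_affine _ _ _ _).
Qed.

Lemma cvg_natinv (K : R) : (fun n => K / n.+1%:R) @ \oo --> (0 : R).
Proof. by rewrite -[X in _ --> X](mulr0 K); apply: cvgM; [exact: cvg_cst|exact: cvg_harmonic]. Qed.

Lemma cutoff_cvg x : - pi < x -> (fun n => cutoff n x) @ \oo --> (1 : R).
Proof.
move=> xpi; have y0 : 0 < x + pi by lra.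
apply: (@squeeze_cvgr _ _ _ _ (fun n => 1 - (2 / (x + pi)) / n.+1%:R) (cst 1)).
- apply: nearW => n; have /andP[_ ->] := cutoff_itv n x; rewrite andbT.
  rewrite /cutoff cutoff_argE.
  have t0 : 0 < n.+1%:R * (x + pi) by rewrite mulr_gt0.
  by have := flat1_lim t0; rewrite invfM mulrA mulrAC.
- rewrite -[X in _ --> X]subr0; apply: cvgB; first exact: cvg_cst.
  exact: cvg_natinv.
- exact: cvg_cst.
Qed.

(* [cutoff' n] is an approximate identity at the left end point. *)
Lemma moment_cvg : (fun n => \int[mu]_(x in `[- pi, pi]) ((x + pi) * cutoff' n x)) @ \oo --> (0 : R).
Proof.
have E n x : (x + pi) * cutoff' n x =
    (n.+1%:R * (x + pi)) * flat 'X^2 (n.+1%:R * (x + pi) - 1).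
  by rewrite /cutoff' cutoff_argE; ring.
have -> : 0 = \int[mu]_(x in `[- pi, pi]) (cst 0 x) :> R.
  by rewrite Rintegral_cst_pi mul0r.
apply: (@Rintegral_cvg_dominated R _ _ _ _ (cst 3)).
- move=> n; apply: continuous_intg => x; apply: cvgM; last exact: continuous_cutoff'.
  by apply: cvgD; [exact: cvg_id|exact: cvg_cst].
- by apply: continuous_intg => x; exact: cvg_cst.
- by apply: continuous_intg => x; exact: cvg_cst.
- move=> x /andP[xpi _]; have y0 : 0 < x + pi by lra.
  apply: (@squeeze_cvgr _ _ _ _ (cst 0) (fun n => 6 / (x + pi) / n.+1%:R)).
  + apply: nearW => n; rewrite mulr_ge0 ?cutoff'_ge0//=; last exact: ltW.
    rewrite E; have [_ /(_ _)] := flatX2_bound (n.+1%:R * (x + pi)).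
    by rewrite mulr_gt0// (mulrC n.+1%:R) invfM mulrA => /(_ isT).
  + exact: cvg_cst.
  + exact: cvg_natinv.
- move=> n x /andP[xpi _]; rewrite ger0_norm; last first.
    by rewrite mulr_ge0 ?cutoff'_ge0//; lra.
  by rewrite E; have [] := flatX2_bound (n.+1%:R * (x + pi)).
Qed.

(** Since [g] is continuous and vanishes at -pi, it lies below e/2 + (M/d)(x + pi). The mass of
    [cutoff'] is at most 1 and its first moment tends to 0. *)
Lemma concentration_cvg g : {within `[- pi, pi], continuous g} ->
  (forall x, 0 <= g x) -> g (- pi) = 0 ->
  (fun n => \int[mu]_(x in `[- pi, pi]) (g x * cutoff' n x)) @ \oo --> (0 : R).
Proof.
move=> cg g0 gpi; have pi0 := pi_gt0 R.
apply/cvgrPdist_le => e e0.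
have [M M0 gM] := within_continuous_bound cg.
have e2 : 0 < e / 2 by lra.
have [|d d0 gd] := @within_continuous_ball R (- pi) pi g (- pi) (e / 2) cg _ e2.
  by apply/andP; split; lra.
have gle x : - pi <= x <= pi -> g x <= e / 2 + M / d * (x + pi).
  move=> /[dup] xab /andP[xa xb]; have [xd|xd] := ltP (x + pi) d.
    have := gd _ xab; rewrite gpi sub0r normrN ler0_norm; last lra.
    rewrite (_ : - (- pi - x) = x + pi); last by ring.
    move=> /(_ xd); rewrite ger0_norm// => ge.
    have : 0 <= M / d * (x + pi) by apply: mulr_ge0; [rewrite divr_ge0// ltW|lra].
    lra.
  have := gM _ xab; rewrite ger0_norm// => gxM.
  have : M <= M / d * (x + pi).
    by rewrite mulrAC ler_pdivlMr// ler_pM2l.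
  lra.
have mcvg := (cvgrPdist_le _ _).1 moment_cvg (e / 2 / (M / d)) _.
near=> n.
have IH : intg (- pi) pi (cutoff' n) by apply: continuous_intg; exact: continuous_cutoff'.
have ImH : intg (- pi) pi (fun x => (x + pi) * cutoff' n x).
  apply: continuous_intg => x; apply: cvgM; last exact: continuous_cutoff'.
  by apply: cvgD; [exact: cvg_id|exact: cvg_cst].
rewrite sub0r normrN ger0_norm; last first.
  by apply: Rintegral_ge0 => x _; rewrite mulr_ge0// cutoff'_ge0.
apply: (@le_trans _ _ (e / 2 * \int[mu]_(x in `[- pi, pi]) cutoff' n x +
   M / d * \int[mu]_(x in `[- pi, pi]) ((x + pi) * cutoff' n x))).
  rewrite -!RintegralZl// -RintegralD//; [|exact: intgZ..].
  apply: le_Rintegral => //.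
  - apply: integrable_mul_continuous; first exact: continuous_integrable.
    by apply: continuous_subspaceT; exact: continuous_cutoff'.
  - by apply: intgD; exact: intgZ.
  - move=> x; rewrite /= in_itv/= => xab.
    by rewrite mulrA -mulrDl ler_wpM2r ?cutoff'_ge0// gle.
have h1 : \int[mu]_(x in `[- pi, pi]) cutoff' n x <= 1.
  rewrite (@Rintegral_deriv_within R _ _ (cutoff n)); first last.
  - by move=> x _; apply: is_derive_deriv_within; exact: is_derive_cutoff.
  - by apply: continuous_subspaceT; exact: continuous_cutoff'.
  - by lra.
  by have := cutoff_itv n pi; have := cutoff_itv n (- pi); lra.
have h2 : M / d * \int[mu]_(x in `[- pi, pi]) ((x + pi) * cutoff' n x) <= e / 2.
  rewrite mulrC -ler_pdivlMr ?divr_gt0//.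
  apply: le_trans (ler_norm _) _; rewrite -normrN -sub0r.
  by near: n; apply: mcvg; rewrite !divr_gt0.
have : e / 2 * \int[mu]_(x in `[- pi, pi]) cutoff' n x <= e / 2 * 1 by rewrite ler_pM2l.
lra.
Unshelve. all: by end_near. Qed.

(* The test functions are [mode k th] times a product of two cutoffs; by periodicity
   [g2] may be replaced by [g2 - g2 pi], which vanishes at both end points, so that
   the derivatives of the cutoffs do not contribute in the limit. *)
Lemma weak_deriv_mode g2 g3 k th :
  {within `[- pi, pi], continuous g2} -> g2 (- pi) = g2 pi ->
  weak_deriv_L2 (- pi) pi g2 g3 ->
  k%:R * fcoef g2 k (th + pi / 2) = fcoef g3 k th.
Proof.
move=> cg2 per W; have pi0 := pi_gt0 R.
have [I3 _] := weak_deriv_intg W.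
case: W => _ [_ W].
pose s := mode k th; pose s' x : R := - k%:R * mode k (th + pi / 2) x.
have Ds x : is_derive x 1 s (s' x) by exact: is_derive_mode.
have cs : continuous s by exact: continuous_mode.
have cs' : continuous s'.
  by move=> x; apply: cvgM; [exact: cvg_cst|exact: continuous_mode].
pose g x := g2 x - g2 pi.
have cg : {within `[- pi, pi], continuous g}.
  by move=> x; apply: cvgB; [exact: cg2|exact: cvg_cst].
(* The mirror image of [cutoff n], acting at the end point pi. *)
pose Kn n x := flat 1 (- n.+1%:R * x + (n.+1%:R * pi - 1)).
have KnE n x : Kn n x = cutoff n (- x) by rewrite /Kn /cutoff mulrN mulNr.
pose chi n x := cutoff n x * Kn n x.
pose chi' n x := cutoff n x * - cutoff' n (- x) + Kn n x * cutoff' n x.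
have Dchi n x : is_derive x 1 (chi n) (chi' n x).
  have DK : is_derive x 1 (Kn n) (- cutoff' n (- x)).
    have := is_derive_flat_affine 1 (- n.+1%:R) (n.+1%:R * pi - 1) x.
    by rewrite derivC subr0 mulr1 /cutoff' !mulrN mulNr.
  exact: is_deriveM (is_derive_cutoff n x) DK.
have cchi n : continuous (chi n) by move=> x; exact: is_derive_continuous (Dchi n x).
have cH n : continuous (cutoff n) by move=> x; exact: is_derive_continuous (is_derive_cutoff n x).
have cHN n : continuous (fun x => cutoff' n (- x)).
  move=> x; apply: (@continuous_comp _ _ _ (fun x => - x) (cutoff' n)).
    by apply: cvgN; exact: cvg_id.
  exact: continuous_cutoff'.
have cK n : continuous (Kn n).
  by move=> x; exact: is_derive_continuous (is_derive_flat_affine _ _ _ _).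
have cchi' n : continuous (chi' n).
  move=> x; apply: cvgD; apply: cvgM.
  - exact: cH.
  - by apply: cvgN; exact: cHN.
  - exact: cK.
  - exact: continuous_cutoff'.
have chi01 n x : 0 <= chi n x <= 1.
  rewrite /chi KnE; have /andP[a0 a1] := cutoff_itv n x; have /andP[b0 b1] := cutoff_itv n (- x).
  by rewrite mulr_ge0//= mulr_ile1.
pose eta n x := s x * chi n x.
pose eta' n x := s x * chi' n x + chi n x * s' x.
have Deta n x : is_derive x 1 (eta n) (eta' n x).
  exact: is_deriveM (Ds x) (Dchi n x).
have Teta n : test_function (- pi) pi (eta n).
  split.
    move=> m x; apply: smooth_derivable; apply: smoothM; first exact: smooth_mode.
    by apply: smoothM; exact: smooth_flat.
  exists n.+1%:R^-1 => [|x]; first by rewrite invr_gt0.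
  have n0 : 0 < n.+1%:R :> R by [].
  have n1 : n.+1%:R * n.+1%:R^-1 = 1 :> R by rewrite divff.
  rewrite /eta /chi => -[xa|xb].
    rewrite [cutoff n x]flat_npos ?mul0r ?mulr0// cutoff_argE.
    have : n.+1%:R * (x + pi) <= n.+1%:R * n.+1%:R^-1.
      by rewrite ler_pM2l// -lerBrDr addrC.
    by rewrite n1; lra.
  rewrite [Kn n x]flat_npos ?mulr0//.
  have : n.+1%:R * (pi - x) <= n.+1%:R * n.+1%:R^-1.
    by rewrite ler_pM2l// lerBlDr -lerBlDl.
  by rewrite n1; lra.
have etaD n : derive1 (eta n) = eta' n.
  by apply/funext => x; have [_ <-] := Deta n x; rewrite derive1E.
have ceta' n : continuous (eta' n).
  move=> x; apply: cvgD; apply: cvgM; [exact: cs|exact: cchi'|exact: cchi|exact: cs'].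
have Ig : intg (- pi) pi g by exact: continuous_integrable.
have Ig2 : intg (- pi) pi g2 by exact: continuous_integrable.
have IM f q : intg (- pi) pi f -> continuous q -> intg (- pi) pi (fun x => f x * q x).
  by move=> If cq; apply: integrable_mul_continuous => //; exact: continuous_subspaceT.
have IM2 q r : continuous q -> continuous r ->
    intg (- pi) pi (fun x => g x * q x * r x).
  by move=> cq cr; apply: (IM) => //; exact: (IM).
have Ic f : continuous f -> intg (- pi) pi f by exact: continuous_intg.
have lt_pi : - pi < pi :> R by lra.
have FTC0 f f' : (forall x, is_derive x 1 f (f' x)) -> continuous f' ->
    f (- pi) = f pi -> \int[mu]_(x in `[- pi, pi]) f' x = 0.
  move=> D cf' E; rewrite (@Rintegral_deriv_within R _ _ f) ?E ?subrr//.
    exact: continuous_subspaceT.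
  by move=> x _; exact: is_derive_deriv_within.
(* Subtracting the constant [g2 pi] changes nothing against a function of integral 0. This is used
   for [eta' n], whose primitive vanishes at both ends, and for [s'], whose primitive is
   periodic. *)
have split_g f : continuous f -> \int[mu]_(x in `[- pi, pi]) f x = 0 ->
    \int[mu]_(x in `[- pi, pi]) (g2 x * f x) = \int[mu]_(x in `[- pi, pi]) (g x * f x).
  move=> cf f0.
  have -> : \int[mu]_(x in `[- pi, pi]) (g x * f x) =
      \int[mu]_(x in `[- pi, pi]) (g2 x * f x - g2 pi * f x).
    by apply: eq_Rintegral => x _; rewrite /g mulrBl.
  have I2f := IM _ _ Ig2 cf; have If := Ic _ cf; have IZ := intgZ (g2 pi) If.
  by rewrite RintegralB// RintegralZl// f0 mulr0 subr0.
have Wn n : \int[mu]_(x in `[- pi, pi]) (g x * s' x * chi n x) +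
    \int[mu]_(x in `[- pi, pi]) (g x * s x * chi' n x) =
    - \int[mu]_(x in `[- pi, pi]) (g3 x * s x * chi n x).
  have eta0 : \int[mu]_(x in `[- pi, pi]) eta' n x = 0.
    apply: (FTC0 (eta n)) => //.
    have [_ [d d0 He]] := Teta n.
    by rewrite !He//; [right|left]; lra.
  have := W _ (Teta n); rewrite etaD => /(congr1 fine); rewrite fineN.
  rewrite -!/(Rintegral _ _ _) (split_g _ (ceta' n) eta0) => E.
  transitivity (\int[mu]_(x in `[- pi, pi]) (g x * eta' n x)); last first.
    by rewrite E; congr (- _); apply: eq_Rintegral => x _; rewrite /eta mulrA.
  rewrite -RintegralD//; [|exact: IM2|exact: IM2].
  by apply: eq_Rintegral => x _; rewrite /eta'; ring.
have chi_cvg x : - pi < x < pi -> (fun n => chi n x) @ \oo --> (1 : R).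
  move=> /andP[xa xb]; rewrite -[X in _ --> X]mulr1; apply: cvgM.
    exact: cutoff_cvg.
  by under eq_fun do rewrite KnE; apply: cutoff_cvg; lra.
have lim1 f : intg (- pi) pi f ->
    (fun n => \int[mu]_(x in `[- pi, pi]) (f x * chi n x)) @ \oo -->
    \int[mu]_(x in `[- pi, pi]) f x.
  move=> If; apply: (@Rintegral_cvg_dominated R _ _ _ _ (fun x => `|f x|)) => //.
  - by move=> n; exact: IM.
  - exact: integrable_norm.
  - move=> x xab; rewrite -[X in _ --> X]mulr1; apply: cvgM; first exact: cvg_cst.
    exact: chi_cvg.
  - move=> n x _; have /andP[c0 c1] := chi01 n x.
    by rewrite normrM (ger0_norm c0) ler_piMr.
have lim2 : (fun n => \int[mu]_(x in `[- pi, pi]) (g x * s x * chi' n x)) @ \oo --> (0 : R).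
  (* Reflection folds the term concentrating at pi onto the one at -pi. [G] vanishes at -pi because
     [g] vanishes at both ends. *)
  pose G x := `|g x| + `|g (- x)|.
  have cgN : {within `[- pi, pi], continuous (fun x => g (- x))}.
    exact: within_continuous_reflect.
  have cG : {within `[- pi, pi], continuous G}.
    by move=> z; apply: cvgD; apply: cvg_norm; [exact: cg|exact: cgN].
  have IGH n : intg (- pi) pi (fun x => G x * cutoff' n x).
    apply: IM; last exact: continuous_cutoff'.
    exact: continuous_integrable.
  have H0 := concentration_cvg cG.
  have {}H0 : (fun n => \int[mu]_(x in `[- pi, pi]) (G x * cutoff' n x)) @ \oo --> (0 : R).
    apply: H0 => [z|]; first by rewrite addr_ge0.
    by rewrite /G /g opprK per subrr normr0 addr0.
  apply: norm_cvg0; apply: (@squeeze_cvgr _ _ _ _ (cst 0) _ _ _ _ _ H0); last exact: cvg_cst.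
  apply: nearW => n; rewrite normr_ge0/=.
  apply: le_trans (le_normr_Rintegral _ _) _ => //; first exact: IM2.
  have Iabs : intg (- pi) pi (fun x => `|g x|) by exact: integrable_norm.
  have IabsN : intg (- pi) pi (fun x => `|g (- x)|).
    by apply: integrable_norm; exact: continuous_integrable.
  have J1 : intg (- pi) pi (fun x => `|g x| * cutoff' n x) by apply: IM => //; exact: continuous_cutoff'.
  have J2 : intg (- pi) pi (fun x => `|g (- x)| * cutoff' n x) by apply: IM => //; exact: continuous_cutoff'.
  have J3 : intg (- pi) pi (fun x => `|g x| * cutoff' n (- x)) by exact: IM.
  apply: (@le_trans _ _ (\int[mu]_(x in `[- pi, pi]) (`|g x| * cutoff' n x + `|g x| * cutoff' n (- x)))).
    apply: le_Rintegral => //.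
    - by apply: integrable_norm; exact: IM2.
    - exact: intgD.
    - move=> z _; rewrite !normrM -mulrDr -mulrA ler_wpM2l//.
      apply: le_trans (_ : _ <= 1 * `|chi' n z|) _.
        by rewrite ler_wpM2r// mode_le1.
      rewrite mul1r /chi'; apply: le_trans (ler_normD _ _) _.
      rewrite addrC (normrM (Kn n z)) (normrM (cutoff n z)) normrN !(ger0_norm (cutoff'_ge0 _ _)) KnE.
      have /andP[a0 a1] := cutoff_itv n z; have /andP[b0 b1] := cutoff_itv n (- z).
      by rewrite (ger0_norm a0) (ger0_norm b0); apply: lerD; rewrite ler_piMl// cutoff'_ge0.
  rewrite RintegralD//.
  rewrite -(@Rintegral_reflect R pi (fun x => `|g x| * cutoff' n (- x)) (ltW pi0)); last first.
    apply: within_continuousM; last exact: continuous_subspaceT.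
    by move=> z; apply: cvg_norm; exact: cg.
  under [X in _ + X]eq_Rintegral do rewrite opprK.
  rewrite -(RintegralD _ J1 J2)//; apply: le_Rintegral => //.
  - exact: intgD.
  - exact: IGH.
  - by move=> z _; rewrite mulrDl.
have LHS : (fun n => - \int[mu]_(x in `[- pi, pi]) (g3 x * s x * chi n x)) @ \oo -->
    \int[mu]_(x in `[- pi, pi]) (g x * s' x).
  rewrite (_ : (fun n => _) = fun n =>
    \int[mu]_(x in `[- pi, pi]) (g x * s' x * chi n x) +
    \int[mu]_(x in `[- pi, pi]) (g x * s x * chi' n x)); last first.
    by apply/funext => n; rewrite Wn.
  rewrite -[X in _ --> X]addr0; apply: cvgD; last exact: lim2.
  exact: (lim1 _ (IM _ _ Ig cs')).
have RHS : (fun n => - \int[mu]_(x in `[- pi, pi]) (g3 x * s x * chi n x)) @ \oo -->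
    - \int[mu]_(x in `[- pi, pi]) (g3 x * s x).
  by apply: cvgN; apply: lim1; exact: IM.
(* The two limits of the weak identity are the integration by parts formula against the uncut mode,
   with [g] still in place of [g2]. *)
have := cvg_unique _ LHS RHS; rewrite -split_g//; last first.
  by apply: (FTC0 s) => //; exact: mode_periodic.
move=> E.
rewrite /fcoef mulrCA; congr (_ * _).
have E2 : \int[mu]_(x in `[- pi, pi]) (g2 x * s' x) =
    - k%:R * \int[mu]_(x in `[- pi, pi]) (g2 x * mode k (th + pi / 2) x).
  rewrite -RintegralZl//; last by apply: IM => //; exact: continuous_mode.
  by apply: eq_Rintegral => x _; rewrite /s'; ring.
by apply/eqP; rewrite -eqr_opp -mulNr -E2 E.
Qed.

End WeakDerivative.

(** * Uniqueness of the regular solution *)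

Section Uniqueness.
Variable R : realType.
Local Notation mu := (@lebesgue_measure R).
Implicit Types (a b c d x r t th T eps : R) (f g : R -> R) (u : R -> R -> R).

Lemma Omega_barP T x t : Omega_bar T (x, t) <-> - pi <= x <= pi /\ 0 <= t <= T.
Proof. by rewrite /Omega_bar /= !in_itv. Qed.

Lemma OmegaP T x t : Omega T (x, t) <-> - pi < x < pi /\ 0 < t < T.
Proof. by rewrite /Omega /= !in_itv. Qed.

Lemma compact_unif_continuous (K : set (R * R)) (h : R * R -> R) (e : R) :
  compact K -> {within K, continuous h} -> 0 < e ->
  exists2 d, 0 < d & forall p q, K p -> K q ->
    `|p.1 - q.1| < d -> `|p.2 - q.2| < d -> `|h p - h q| < e.
Proof.
move=> /compact_near_coveringP cK /subspace_continuousP ch e0.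
have e2 : 0 < e / 2 by lra.
(* Heine-Cantor through near-coverings: near each point of [K] small [d] works by continuity at that
   point, and compactness yields one range of [d] valid on all of [K]. *)
have [p Kp|d0 /= d00 Hd] := cK _ (0 : R)^'+ (fun d p => forall q, K p -> K q ->
    `|p.1 - q.1| < d -> `|p.2 - q.2| < d -> `|h p - h q| < e) _ _.
  have /cvgrPdist_lt/(_ _ e2) := ch p Kp.
  rewrite near_withinE => /nbhs_ballP[r /= r0 Hr].
  exists (ball p (r / 2), [set d | d < r / 2]).
    split; first by apply: nbhsx_ballx; rewrite divr_gt0.
    by apply: nbhs_right_lt; rewrite divr_gt0.
  move=> [p' d] [/= [pp1 pp2] dr] q Kp' Kq pq1 pq2.
  have h1 : `|h p - h p'| < e / 2.
    by apply: Hr => //; move: pp1 pp2; rewrite /ball/= => ? ?; split; rewrite /ball/=; lra.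
  have h2 : `|h p - h q| < e / 2.
    apply: Hr => //; split; rewrite /ball/=.
      have := ler_distD p'.1 p.1 q.1; move: pp1; rewrite /ball/=; lra.
    have := ler_distD p'.2 p.2 q.2; move: pp2; rewrite /ball/=; lra.
  by have := ler_distD (h p) (h p') (h q); rewrite (distrC (h p') (h p)); lra.
exists (d0 / 2); first by rewrite divr_gt0.
move=> p q Kp Kq; apply: (Hd (d0 / 2)) => //=.
  by rewrite /ball/= sub0r normrN gtr0_norm; lra.
by rewrite divr_gt0.
Qed.

Lemma compact_rect a b c d : compact (`[a, b]%classic `*` `[c, d]%classic : set (R * R)).
Proof. by apply: compact_setX; exact: segment_compact. Qed.

Lemma compact_Omega_bar T : compact (Omega_bar T).
Proof. exact: compact_rect. Qed.

Lemma within_slice_x (K : set (R * R)) (h : R * R -> R) a b t :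
  {within K, continuous h} -> (forall x, a <= x <= b -> K (x, t)) ->
  {within `[a, b], continuous (fun x => h (x, t))}.
Proof.
move=> /subspace_continuousP ch aK; apply/subspace_continuousP => x.
rewrite /= in_itv/= => xab; apply/cvgrPdist_lt => e e0.
have /cvgrPdist_lt/(_ _ e0) := ch (x, t) (aK x xab).
rewrite near_withinE => /nbhs_ballP[r r0 Hr].
rewrite near_withinE; apply/nbhs_ballP; exists r => // y xy.
rewrite /= in_itv/= => yab; apply: Hr; last exact: aK.
by split => //; exact: ballxx.
Qed.

Lemma Rintegral_le_bound a b f (M : R) : a <= b -> intg a b f ->
  (forall x, a <= x <= b -> `|f x| <= M) ->
  `|\int[mu]_(x in `[a, b]) f x| <= M * (b - a).
Proof.
move=> ab If fM; apply: le_trans (le_normr_Rintegral _ If) _ => //.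
have <- : \int[mu]_(x in `[a, b]) M = M * (b - a).
  rewrite Rintegral_cst//= lebesgue_measure_itv/= lte_fin.
  case: ltP => // ba; have -> : b = a by apply/eqP; rewrite eq_le ba ab.
  by rewrite subrr.
apply: le_Rintegral => //.
- exact: integrable_norm.
- by apply: continuous_intg => x; exact: cvg_cst.
Qed.

Lemma Rintegral_split a c b f : a <= c -> c <= b -> intg a b f ->
  \int[mu]_(x in `[a, b]) f x =
  \int[mu]_(x in `[a, c]) f x + \int[mu]_(x in `[c, b]) f x.
Proof.
move=> ac cb If; rewrite -(Rintegral_itv_obnd_cbnd (r := c) (b := BRight b)).
  have ac' : (BLeft a <= BRight c)%O by rewrite bnd_simp.
  have cb' : (BRight c <= BRight b)%O by rewrite bnd_simp.
  by rewrite -(Rintegral_itvB If ac' cb') addrC subrK.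
by apply: integrableS If => //; apply: subset_itv; rewrite bnd_simp.
Qed.

Lemma intg_sub a b c d f : a <= c -> d <= b -> intg a b f -> intg c d f.
Proof.
by move=> ac db; apply: integrableS => //; apply: subset_itv; rewrite bnd_simp.
Qed.

Lemma Rintegral_shrink r f (M : R) : 0 <= r -> r <= pi ->
  intg (- pi) pi f -> (forall x, - pi <= x <= pi -> `|f x| <= M) ->
  `|\int[mu]_(x in `[- pi, pi]) f x - \int[mu]_(x in `[- r, r]) f x|
    <= 2 * M * (pi - r).
Proof.
move=> r0 rpi If fM.
rewrite (@Rintegral_split _ (- r)) //; [|lra..].
rewrite (@Rintegral_split (- r) r) //; [|lra..|by apply: intg_sub If; lra].
rewrite addrC addrA [X in `|X|](_ : _ = \int[mu]_(x in `[r, pi]) f x +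
  \int[mu]_(x in `[- pi, - r]) f x); last by ring.
apply: le_trans (ler_normD _ _) _.
have I1 : `|\int[mu]_(x in `[r, pi]) f x| <= M * (pi - r).
  apply: Rintegral_le_bound => //; first by apply: intg_sub If; lra.
  by move=> x /andP[? ?]; apply: fM; apply/andP; split; lra.
have I2 : `|\int[mu]_(x in `[- pi, - r]) f x| <= M * (- r - - pi).
  apply: Rintegral_le_bound => //; [lra|by apply: intg_sub If; lra|].
  by move=> x /andP[? ?]; apply: fM; apply/andP; split; lra.
by move: I1 I2; rewrite opprK; lra.
Qed.

(** The substitution x to -x on a symmetric interval moves the reflection from [p] onto [c], where
    it costs only the sign [sg]; the nonlocal term thus becomes a scalar factor. *)
Lemma Rintegral_involution r eps (sg : R) (c p f : R -> R) : 0 < r ->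
  {within `[- r, r], continuous p} -> continuous c -> intg (- r) r f ->
  (forall x, c (- x) = sg * c x) ->
  \int[mu]_(x in `[- r, r]) ((p x - eps * p (- x) + f x) * c x) =
  (1 - sg * eps) * \int[mu]_(x in `[- r, r]) (p x * c x)
  + \int[mu]_(x in `[- r, r]) (f x * c x).
Proof.
move=> r0 cp cc If csg.
have ccr : {within `[- r, r], continuous c} by exact: continuous_subspaceT.
have I1 : intg (- r) r (fun x => p x * c x) :=
  integrable_mul_continuous (continuous_integrable cp) ccr.
have I2 : intg (- r) r (fun x => p (- x) * c x) :=
  integrable_mul_continuous (continuous_integrable (within_continuous_reflect cp)) ccr.
have I3 : intg (- r) r (fun x => f x * c x) := integrable_mul_continuous If ccr.
have -> : \int[mu]_(x in `[- r, r]) ((p x - eps * p (- x) + f x) * c x) =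
    \int[mu]_(x in `[- r, r]) (p x * c x - eps * (p (- x) * c x) + f x * c x).
  by apply: eq_Rintegral => x _; ring.
rewrite RintegralD//; last by apply: intgB => //; exact: intgZ.
rewrite RintegralB//; last exact: intgZ.
rewrite RintegralZl//.
have -> : \int[mu]_(x in `[- r, r]) (p (- x) * c x) =
    sg * \int[mu]_(x in `[- r, r]) (p x * c x).
  rewrite -RintegralZl//.
  rewrite -(@Rintegral_reflect R r (fun x => sg * (p x * c x)) (ltW r0)); last first.
    apply: within_continuousM; first by move=> x; exact: cvg_cst.
    exact: within_continuousM.
  by apply: eq_Rintegral => x _; have := csg (- x); rewrite opprK => ->; ring.
by ring.
Qed.

(** The primitive of exp (lam t) that vanishes at 0. The constant mode has lam = 0, where (exp (lam
    t) - 1) / lam must be replaced by [t]. *)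
Lemma exists_growth (lam : R) : exists G : R -> R,
  G 0 = 0 /\ forall t, is_derive t 1 G (expR (lam * t)).
Proof.
have [->|l0] := eqVneq lam 0.
  exists id; split=> // t; rewrite mul0r expR0; exact: is_derive_id.
exists (fun t => lam^-1 * (expR (lam * t) - 1)); split.
  by rewrite mulr0 expR0 subrr mulr0.
move=> t.
have D1 : is_derive t 1 (fun t => lam * t) lam.
  by apply: is_derive_eq; rewrite /GRing.scale/= mulr1.
have D2 := @is_derive1_comp R expR (fun t => lam * t) t _ _ (is_derive_expR _) D1.
have := is_deriveZ lam^-1 (is_deriveB D2 (is_derive_cst (1 : R) t 1)).
by move/is_derive_eq; apply; rewrite subr0 /GRing.scale/= mulrCA mulVf// mulr1.
Qed.

Lemma is_derive_expR_lin (lam t : R) :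
  is_derive t 1 (fun t => expR (lam * t)) (expR (lam * t) * lam).
Proof.
have D1 : is_derive t 1 (fun t => lam * t) lam.
  by apply: is_derive_eq; rewrite /GRing.scale/= mulr1.
exact: (@is_derive1_comp R expR (fun t => lam * t) t _ _ (is_derive_expR _) D1).
Qed.

(** * The mode equation satisfied by an arbitrary regular solution *)

Section Modes.
Variables (T eps : R) (phi psi : R -> R) (u : R -> R -> R) (f : R -> R).
Hypotheses (T0 : 0 < T) (reg : regular_solution T eps phi psi u f).

Lemma reg_slice t : 0 <= t <= T -> {within `[- pi, pi], continuous (u ^~ t)}.
Proof.
move=> tT; case: reg => _ [_ [_ [cu _]]].
by apply: (within_slice_x cu) => x xpi; apply/Omega_barP.
Qed.

Lemma reg_at_slice (h : R -> R -> R) r t : 0 < t < T -> r < pi ->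
  (forall p, Omega T p -> {for p, continuous (fun q : R * R => h q.1 q.2)}) ->
  {within `[- r, r], continuous (h ^~ t)}.
Proof.
move=> tT rpi ch; apply/subspace_continuousP => x; rewrite /= in_itv/= => /andP[? ?].
have O : Omega T (x, t) by apply/OmegaP; split => //; apply/andP; split; lra.
apply/cvgrPdist_lt => e e0.
have /cvgrPdist_lt/(_ _ e0) := ch _ O.
move=> /nbhs_ballP[d d0 Hd].
rewrite near_withinE; apply/nbhs_ballP; exists d => // y xy _.
by apply: (Hd (y, t)); split => //; exact: ballxx.
Qed.

Lemma is_derive_pdt x t : Omega T (x, t) -> is_derive t 1 (u x) (pdt u x t).
Proof.
move=> O; case: reg => _ [/(_ _ _ O)[D _ _] _].
by rewrite /pdt derive1E; exact: derivableP.
Qed.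

Lemma is_derive_pdx x t : Omega T (x, t) -> is_derive x 1 (u ^~ t) (pdx u x t).
Proof.
move=> O; case: reg => _ [/(_ _ _ O)[_ D _] _].
by rewrite /pdx derive1E; exact: derivableP.
Qed.

Lemma is_derive_pdxx x t : Omega T (x, t) ->
  is_derive x 1 (fun y => pdx u y t) (pdxx u x t).
Proof.
move=> O; case: reg => _ [/(_ _ _ O)[_ _ D] _].
by rewrite /pdxx derive1E; exact: derivableP.
Qed.

Lemma Omega_pdt_bound r t1 t2 : 0 < t1 -> t2 < T -> r < pi ->
  exists2 M, 0 < M & forall x t, - r <= x <= r -> t1 <= t <= t2 -> `|pdt u x t| <= M.
Proof.
move=> t10 t2T rpi; case: reg => _ [_ [cc _]].
have cK := @compact_rect (- r) r t1 t2.
have ch : {within `[- r, r]%classic `*` `[t1, t2]%classic,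
    continuous (fun q : R * R => pdt u q.1 q.2)}.
  apply: continuous_in_subspaceT => p /set_mem[/= p1 p2].
  suff /cc[_ H _ _] : Omega T p by exact: H.
  move: p1 p2; rewrite /= !in_itv/= => /andP[? ?] /andP[? ?].
  by split; rewrite /= in_itv/=; apply/andP; split; lra.
have /compact_bounded[M [_ HM]] := continuous_compact ch cK.
exists (`|M| + 1) => [|x t xr tt]; first by have := normr_ge0 M; lra.
apply: HM; first by have := ler_norm M; lra.
by exists (x, t) => //; split; rewrite /= in_itv.
Qed.

Variables (k : nat) (th sg : R).
Hypothesis sgE : forall x, mode k th (- x) = sg * mode k th x.
Local Notation beta := (1 - sg * eps).
Local Notation lam := (beta * k%:R ^+ 2).
Let c := mode k th.
Let c1 x : R := - k%:R * mode k (th + pi / 2) x.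

Lemma is_derive_c x : is_derive x 1 c (c1 x).
Proof. exact: is_derive_mode. Qed.

Lemma is_derive_c1 x : is_derive x 1 c1 (- k%:R ^+ 2 * c x).
Proof.
have := is_deriveZ (- k%:R) (is_derive_mode k (th + pi / 2) x).
move/is_derive_eq; apply; rewrite mode_oppth /GRing.scale/= /c; ring.
Qed.

Lemma continuous_c : continuous c. Proof. exact: continuous_mode. Qed.
Lemma continuous_c1 : continuous c1.
Proof. by move=> x; exact: is_derive_continuous (is_derive_c1 x). Qed.

(** The boundary terms of Green's formula on [-r, r], left by two integrations by parts that move
    u_xx onto the mode. *)
Let B r t := (c r * pdx u r t - c1 r * u r t) -
  (c (- r) * pdx u (- r) t - c1 (- r) * u (- r) t).

Lemma Rintegral_pdxx r t : 0 < r -> r < pi -> 0 < t < T ->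
  \int[mu]_(x in `[- r, r]) (pdxx u x t * c x) =
  B r t - k%:R ^+ 2 * \int[mu]_(x in `[- r, r]) (u x t * c x).
Proof.
move=> r0 rpi tT.
have O x : - r <= x <= r -> Omega T (x, t).
  by move=> /andP[? ?]; apply/OmegaP; split => //; apply/andP; split; lra.
have [_ [_ [ch _]]] := reg.
have rr : - r < r by lra.
have S (h : R -> R -> R) : (forall p, Omega T p -> {for p, continuous (fun q : R * R => h q.1 q.2)}) ->
    {within `[- r, r], continuous (h ^~ t)}.
  exact: reg_at_slice.
have cu : {within `[- r, r], continuous (u ^~ t)} by apply: S => p /ch[].
have cux : {within `[- r, r], continuous (fun x => pdx u x t)} by apply: (S (pdx u)) => p /ch[].
have cuxx : {within `[- r, r], continuous (fun x => pdxx u x t)} by apply: (S (pdxx u)) => p /ch[].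
under eq_Rintegral do rewrite mulrC.
rewrite (@Rintegral_by_parts_within R _ _ c c1 (fun x => pdx u x t) (fun x => pdxx u x t))//;
  first last.
- by move=> x /O xO; apply: is_derive_deriv_within; exact: is_derive_pdxx.
- by move=> x _; apply: is_derive_deriv_within; exact: is_derive_c.
- exact: continuous_subspaceT continuous_c1.
rewrite (@Rintegral_by_parts_within R _ _ c1 (fun x => - k%:R ^+ 2 * c x)
  (u ^~ t) (fun x => pdx u x t))//; first last.
- by move=> x /O xO; apply: is_derive_deriv_within; exact: is_derive_pdx.
- by move=> x _; apply: is_derive_deriv_within; exact: is_derive_c1.
- by apply: continuous_subspaceT => x; apply: cvgM; [exact: cvg_cst|exact: continuous_c].
have -> : \int[mu]_(x in `[- r, r]) (- k%:R ^+ 2 * c x * u x t) =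
    - k%:R ^+ 2 * \int[mu]_(x in `[- r, r]) (u x t * c x).
  rewrite -RintegralZl//; first by apply: eq_Rintegral => x _; ring.
  by apply: integrable_mul_continuous;
    [exact: continuous_integrable|exact: continuous_subspaceT continuous_c].
by rewrite /B; ring.
Qed.

Lemma Rintegral_pdt r t : 0 < r -> r < pi -> 0 < t < T ->
  \int[mu]_(x in `[- r, r]) (pdt u x t * c x) =
  beta * B r t - lam * \int[mu]_(x in `[- r, r]) (u x t * c x)
  + \int[mu]_(x in `[- r, r]) (f x * c x).
Proof.
move=> r0 rpi tT.
have [cf [_ [ch [_ [_ [eqn _]]]]]] := reg.
have cuxx : {within `[- r, r], continuous (fun x => pdxx u x t)}.
  by apply: (@reg_at_slice (pdxx u)) => // p /ch[].
have -> : \int[mu]_(x in `[- r, r]) (pdt u x t * c x) =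
  \int[mu]_(x in `[- r, r]) ((pdxx u x t - eps * pdxx u (- x) t + f x) * c x).
  apply: eq_Rintegral => x /set_mem; rewrite /= in_itv/= => /andP[? ?].
  have O : Omega T (x, t) by apply/OmegaP; split => //; apply/andP; split; lra.
  have := eqn x t O.
  move: (pdt u x t) (pdxx u x t) (pdxx u (- x) t) (f x) => p1 p2 p3 p4 <-.
  by congr (_ * _); ring.
have If : intg (- r) r f.
  by apply: (@intg_sub (- pi) pi); [lra|lra|exact: continuous_integrable].
rewrite (@Rintegral_involution r eps sg c (fun x => pdxx u x t) f r0 cuxx continuous_c If sgE).
rewrite Rintegral_pdxx//.
move: (B r t) (Rintegral _ _ _) (Rintegral _ _ _) => b1 b2 b3; ring.
Qed.

Lemma is_derive_coef r t : 0 < r -> r < pi -> 0 < t < T ->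
  is_derive t 1 (fun s => \int[mu]_(x in `[- r, r]) (u x s * c x))
    (\int[mu]_(x in `[- r, r]) (pdt u x t * c x)).
Proof.
move=> r0 rpi /andP[t0 tT].
have [_ [_ [ch _]]] := reg.
(* The time window from t/2 to (t+T)/2 surrounds [t] and stays away from 0 and T, so a constant
   dominates u_t under the integral. *)
have [||M M0 HM] := @Omega_pdt_bound r (t / 2) ((t + T) / 2) _ _ rpi; [lra|lra|].
have D s x : `]t / 2, (t + T) / 2[%classic s -> `[- r, r]%classic x ->
    is_derive s 1 (fun s => u x s * c x) (pdt u x s * c x).
  rewrite /= !in_itv/= => /andP[? ?] /andP[? ?].
  have O : Omega T (x, s) by apply/OmegaP; split; apply/andP; split; lra.
  have := is_deriveM (is_derive_pdt O) (is_derive_cst (c x) s 1).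
  by move/is_derive_eq; apply; rewrite scaler0 add0r /GRing.scale/= mulrC.
have pE s x : `]t / 2, (t + T) / 2[%classic s -> `[- r, r]%classic x ->
    partial1of2 (fun s x => u x s * c x) s x = pdt u x s * c x.
  by move=> Hs Hx; rewrite /partial1of2 derive1E; have [_ ->] := D _ _ Hs Hx.
have tI : `]t / 2, (t + T) / 2[%classic t.
  by rewrite /= in_itv/=; apply/andP; split; lra.
have intf : forall s, `]t / 2, (t + T) / 2[%classic s ->
    mu.-integrable `[- r, r] (EFin \o (fun x => u x s * c x)).
  move=> s; rewrite /= in_itv/= => /andP[? ?].
  apply: integrable_mul_continuous; last exact: continuous_subspaceT continuous_c.
  apply: continuous_integrable; apply: reg_at_slice => //.
    by apply/andP; split; lra.
  by move=> p /ch[].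
have IM : mu.-integrable `[- r, r] (EFin \o (fun=> M)).
  by apply: continuous_intg => x; exact: cvg_cst.
have H := @cvg_differentiation_under_integral R _ _ mu (fun s x => u x s * c x)
  `[- r, r]%classic (measurable_itv _) t (t / 2) ((t + T) / 2) tI intf.
have {}H := H (fun s x Hs Hx => @ex_derive _ _ _ _ _ _ _ (D s x Hs Hx)) (fun=> M) (fun=> ltW M0) IM.
have {}H : h^-1 *: (\int[mu]_(x in `[- r, r]) (u x (h + t) * c x) -
    \int[mu]_(x in `[- r, r]) (u x t * c x)) @[h --> 0^'] -->
    \int[mu]_(x in `[- r, r]) (pdt u x t * c x).
  have -> : \int[mu]_(x in `[- r, r]) (pdt u x t * c x) =
    \int[mu]_(x in `[- r, r]) (partial1of2 (fun s x => u x s * c x) t x).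
    by apply: eq_Rintegral => x /set_mem xr; rewrite pE.
  apply: H => s x Hs Hx; rewrite pE// normrM.
  apply: le_trans (_ : _ <= `|pdt u x s| * 1) _.
    by rewrite ler_wpM2l// mode_le1.
  rewrite mulr1; move: Hs Hx; rewrite /= !in_itv/= => /andP[? ?] /andP[? ?].
  by apply: HM; apply/andP; split; lra.
apply: is_derive_quot; apply: cvg_trans H; apply: near_eq_cvg; near=> h.
by rewrite /GRing.scale/= mulrC [h + t]addrC.
Unshelve. all: by end_near. Qed.


(* [u] and [u_x] are continuous up to the boundary and periodic, whereas [u_t] and
   [u_xx] are only controlled inside: this is why everything is done on [-r, r]. *)
Lemma reg_boundary_cvg (e : R) : 0 < e ->
  exists2 d, 0 < d & forall r t, 0 < r < pi -> pi - r < d -> 0 < t < T -> `|B r t| <= e.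
Proof.
move=> e0; have pi0 := pi_gt0 R.
case: reg => _ [_ [_ [cu [[ux [Dux cux uxper]] [_ [_ uper]]]]]].
pose b (q : R * R) := c q.1 * ux q.1 q.2 - c1 q.1 * u q.1 q.2.
have fstc (g : R -> R) : continuous g -> continuous (fun q : R * R => g q.1).
  move=> cg q; apply: continuous_comp; last exact: cg.
  exact: cvg_fst.
have cb : {within Omega_bar T, continuous b}.
  move=> q; apply: cvgB; apply: cvgM.
  - exact: (continuous_subspaceT (fstc _ continuous_c)).
  - exact: cux.
  - exact: (continuous_subspaceT (fstc _ continuous_c1)).
  - exact: cu.
have e2 : 0 < e / 2 by lra.
have [d d0 Hd] := compact_unif_continuous (@compact_Omega_bar T) cb e2.
exists d => // r t /andP[r0 rpi] rd /andP[t0 tT].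
have t01 : 0 <= t <= T by apply/andP; split; lra.
have pdxE x : - pi < x < pi -> pdx u x t = ux x t.
  move=> xpi; have O : Omega T (x, t) by apply/OmegaP; rewrite xpi t0 tT.
  have Ob : Omega_bar T (x, t).
    by apply/Omega_barP; split => //; case/andP: xpi => ? ?; apply/andP; split; lra.
  have [_ <-] := is_derive_pdx O.
  by have [_ <-] := deriv_within_is_derive xpi (Dux _ _ Ob).
have Bb : B r t = b (r, t) - b (- r, t).
  rewrite /B !pdxE//; apply/andP; split; lra.
(* At r = pi the boundary terms cancel by periodicity; uniform continuity transfers this to nearby
   [r], each end costing e/2. *)
have bper : b (- pi, t) = b (pi, t).
  rewrite /b /= uxper// uper//; congr (_ * _ - _ * _); first exact: mode_periodic.
  by rewrite /c1 mode_periodic.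
have Ob x : - pi <= x <= pi -> Omega_bar T (x, t) by move=> xpi; apply/Omega_barP.
have h1 : `|b (r, t) - b (pi, t)| < e / 2.
  apply: Hd => /=; [apply: Ob|apply: Ob| |by rewrite subrr normr0].
  - by apply/andP; split; lra.
  - by apply/andP; split; lra.
  - by rewrite distrC gtr0_norm; lra.
have h2 : `|b (- pi, t) - b (- r, t)| < e / 2.
  apply: Hd => /=; [apply: Ob|apply: Ob| |by rewrite subrr normr0].
  - by apply/andP; split; lra.
  - by apply/andP; split; lra.
  - by rewrite opprK [- pi + r]addrC distrC gtr0_norm; lra.
rewrite Bb (_ : _ - _ = (b (r, t) - b (pi, t)) + (b (- pi, t) - b (- r, t))).
  by apply: le_trans (ler_normD _ _) _; lra.
by rewrite bper addrA subrK.
Qed.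

Let U t := \int[mu]_(x in `[- pi, pi]) (u x t * c x).
Let F := \int[mu]_(x in `[- pi, pi]) (f x * c x).

Lemma reg_intg_uc t : 0 <= t <= T -> intg (- pi) pi (fun x => u x t * c x).
Proof.
move=> tT; apply: integrable_mul_continuous.
  exact: continuous_integrable (reg_slice tT).
exact: continuous_subspaceT continuous_c.
Qed.

(** The mode equation holds only for 0 < t < T; continuity carries its consequences to t = 0 and t =
    T, where the data are prescribed. *)
Lemma reg_coef_continuous : {within `[0, T], continuous U}.
Proof.
have pi0 := pi_gt0 R.
case: reg => _ [_ [_ [cu _]]].
apply/subspace_continuousP => t; rewrite /= in_itv/= => tT.
apply/cvgrPdist_le => e e0.
have e1 : 0 < e / (2 * pi) by rewrite divr_gt0// mulr_gt0.
have [d d0 Hd] := compact_unif_continuous (@compact_Omega_bar T) cu e1.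
rewrite near_withinE; apply/nbhs_ballP; exists d => // s ts; rewrite /= in_itv/= => sT.
rewrite -RintegralB//; [|exact: reg_intg_uc..].
have -> : e = e / (2 * pi) * (pi - - pi).
  by rewrite (_ : pi - - pi = 2 * pi); [rewrite divfK// mulf_neq0// gt_eqF|ring].
apply: Rintegral_le_bound; first lra.
  by apply: intgB; exact: reg_intg_uc.
move=> x xpi; rewrite -mulrBl normrM -[leRHS]mulr1 ler_pM//; last exact: mode_le1.
apply: ltW; apply: (Hd (x, t) (x, s)); [exact/Omega_barP|exact/Omega_barP| |exact: ts].
by rewrite subrr normr0.
Qed.

Lemma reg_coef_identity (G : R -> R) :
  G 0 = 0 -> (forall t, is_derive t 1 G (expR (lam * t))) ->
  forall t, 0 <= t <= T -> expR (lam * t) * U t =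
    \int[mu]_(x in `[- pi, pi]) (phi x * c x) + G t * F.
Proof.
move=> G0 DG; have pi0 := pi_gt0 R.
case: (reg) => cf [_ [_ [cu [_ [_ [uphi _]]]]]].
pose W t := expR (lam * t) * U t - G t * F.
have If : intg (- pi) pi (fun x => f x * c x).
  apply: integrable_mul_continuous; first exact: continuous_integrable.
  exact: continuous_subspaceT continuous_c.
have [Mf Mf0 HMf] : exists2 M, 0 < M & forall x, - pi <= x <= pi -> `|f x * c x| <= M.
  have [M M0 HM] := within_continuous_bound cf; exists M => // x xpi.
  by rewrite normrM -[leRHS]mulr1 ler_pM// ?HM// mode_le1.
have [Mu Mu0 HMu] : exists2 M, 0 < M & forall x t, - pi <= x <= pi -> 0 <= t <= T ->
    `|u x t * c x| <= M.
  have /compact_bounded[M [_ HM]] := continuous_compact cu (@compact_Omega_bar T).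
  exists (`|M| + 1) => [|x t xpi tT]; first by have := normr_ge0 M; lra.
  rewrite normrM -[leRHS]mulr1 ler_pM//; last exact: mode_le1.
  apply: HM; first by have := ler_norm M; lra.
  by exists (x, t) => //; exact/Omega_barP.
pose E := expR (`|lam| * T).
have E0 : 0 < E by exact: expR_gt0.
have HE t : 0 <= t <= T -> expR (lam * t) <= E.
  move=> /andP[t0 tT]; rewrite ler_expR; apply: le_trans (_ : _ <= `|lam| * t) _.
    by rewrite ler_wpM2r// ler_norm.
  by rewrite ler_wpM2l.
(* [V r] is [W] with both integrals cut to [-r, r], where differentiation in [t] is allowed. In its
   derivative the terms with [lam] and with [f] cancel, and only the boundary terms remain. *)
pose V r t := expR (lam * t) * \int[mu]_(x in `[- r, r]) (u x t * c x)
  - G t * \int[mu]_(x in `[- r, r]) (f x * c x).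
have DV r t : 0 < r -> r < pi -> 0 < t < T ->
    is_derive t 1 (V r) (expR (lam * t) * (beta * B r t)).
  move=> r0 rpi tT.
  have D1 := is_deriveM (is_derive_expR_lin lam t) (is_derive_coef r0 rpi tT).
  have D2 := is_deriveM (DG t) (is_derive_cst (\int[mu]_(x in `[- r, r]) (f x * c x)) t 1).
  have := is_deriveB D1 D2; move/is_derive_eq; apply.
  rewrite Rintegral_pdt// scaler0 add0r /GRing.scale/=.
  move: (Rintegral _ _ _) (Rintegral _ _ _) (B r t) (expR _) => i1 i2 b1 x1; ring.
have WV r t : 0 < r -> r < pi -> 0 <= t <= T ->
    `|W t - V r t| <= (E * (2 * Mu) + `|G t| * (2 * Mf)) * (pi - r).
  move=> r0 rpi tT.
  rewrite /W /V (_ : _ - _ = expR (lam * t) *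
      (U t - \int[mu]_(x in `[- r, r]) (u x t * c x)) -
    G t * (F - \int[mu]_(x in `[- r, r]) (f x * c x))); last by ring.
  apply: le_trans (ler_normB _ _) _; rewrite [leRHS]mulrDl; apply: lerD; rewrite normrM -[leRHS]mulrA.
    apply: ler_pM => //; first by rewrite (gtr0_norm (expR_gt0 _)) HE.
    apply: Rintegral_shrink; [exact: ltW|exact: ltW|exact: reg_intg_uc|].
    by move=> x xpi; exact: HMu.
  rewrite ler_wpM2l//; apply: Rintegral_shrink => //; exact: ltW.
have Wcst t1 t2 : 0 < t1 -> t1 <= t2 -> t2 < T -> W t1 = W t2.
  move=> t10 t12 t2T; apply/eqP; rewrite -subr_eq0 -normr_le0; apply/ler_addgt0Pl => e e0.
  rewrite addr0.
  (* [K1] times pi - r bounds the cost of replacing [W] by [V r] at both times, and [K2] times the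
     boundary bound controls the variation of [V r] between them; each contributes at most e/2. The
     summand 1 beside |beta| makes [K2] positive whatever [beta] is. *)
  pose K1 := (E * (2 * Mu) + `|G t1| * (2 * Mf)) + (E * (2 * Mu) + `|G t2| * (2 * Mf)).
  have K10 : 0 < K1.
    have : 0 < E * (2 * Mu) by rewrite !mulr_gt0.
    have : 0 <= `|G t1| * (2 * Mf) by rewrite !mulr_ge0// ltW.
    have : 0 <= `|G t2| * (2 * Mf) by rewrite !mulr_ge0// ltW.
    by rewrite /K1; lra.
  pose K2 := E * (`|beta| + 1) * T.
  have K20 : 0 < K2.
    by rewrite !mulr_gt0//; have := normr_ge0 beta; lra.
  have [|d d0 Hd] := @reg_boundary_cvg (e / 2 / K2); first by rewrite !divr_gt0.
  pose h := Num.min (pi / 2) (Num.min (d / 2) (e / 2 / K1)).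
  have h0 : 0 < h by rewrite !lt_min !divr_gt0.
  have hpi : h <= pi / 2 by rewrite ge_min lexx.
  have hd : h < d by rewrite !gt_min; apply/or3P; apply: Or32; lra.
  have hK : h <= e / 2 / K1 by rewrite !ge_min lexx !orbT.
  pose r := pi - h.
  have r0 : 0 < r by rewrite /r; lra.
  have rpi : r < pi by rewrite /r; lra.
  have prh : pi - r = h by rewrite /r; ring.
  have T1 : 0 <= t1 <= T by rewrite (ltW t10) (ltW (le_lt_trans t12 t2T)).
  have T2 : 0 <= t2 <= T by rewrite (ltW t2T) (le_trans (ltW t10) t12).
  have v1 := WV r t1 r0 rpi T1; have v2 := WV r t2 r0 rpi T2.
  rewrite prh in v1 v2.
  have yT y : t1 <= y <= t2 -> 0 < y < T.
    by move=> /andP[y1 y2]; rewrite (lt_le_trans t10 y1) (le_lt_trans y2 t2T).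
  have DVy y : t1 <= y <= t2 ->
      is_derive y 1 (V r) (expR (lam * y) * (beta * B r y)).
    by move=> /yT yT'; exact: DV.
  have bndy y : t1 <= y <= t2 -> `|expR (lam * y) * (beta * B r y)| <=
      E * (`|beta| + 1) * (e / 2 / K2).
    move=> /yT /[dup] yT' /andP[y0 y1].
    rewrite 2!normrM -[leRHS]mulrA; apply: ler_pM.
    - exact: normr_ge0.
    - exact: mulr_ge0 (normr_ge0 _) (normr_ge0 _).
    - rewrite (gtr0_norm (expR_gt0 (lam * y))); apply: HE.
      by rewrite (ltW y0) (ltW y1).
    - apply: ler_pM; [exact: normr_ge0|exact: normr_ge0|by rewrite lerDl|].
      apply: Hd; [by rewrite r0 rpi|by rewrite prh|exact: yT'].
  have v12 := mean_value_le t12 DVy bndy.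
  have v12' : `|V r t2 - V r t1| <= e / 2.
    apply: le_trans v12 _.
    apply: le_trans (_ : _ <= K2 * (e / 2 / K2)) _; last first.
      by rewrite [K2 * _]mulrC divfK// gt_eqF.
    have -> : K2 * (e / 2 / K2) = E * (`|beta| + 1) * (e / 2 / K2) * T.
      by rewrite {1}/K2 mulrAC.
    apply: ler_wpM2l; last by rewrite lerBlDr (le_trans (ltW t2T))// lerDl ltW.
    have b0 : 0 <= `|beta| + 1 by rewrite addr_ge0.
    have eK : 0 <= e / 2 / K2 by rewrite !divr_ge0// ltW.
    exact: mulr_ge0 (mulr_ge0 (ltW E0) b0) eK.
  have hK1 : K1 * h <= e / 2 by rewrite mulrC -ler_pdivlMr.
  rewrite (_ : W t1 - W t2 = (W t1 - V r t1) - (V r t2 - V r t1) - (W t2 - V r t2)); last by ring.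
  apply: le_trans (ler_normB _ _) _; have := ler_normB (W t1 - V r t1) (V r t2 - V r t1).
  move: hK1; rewrite /K1 mulrDl => hK1 ?; lra.
have cW : {within `[0, T], continuous W}.
  move=> t; apply: cvgB; apply: cvgM.
  - apply: continuous_subspaceT => s; exact: is_derive_continuous (is_derive_expR_lin lam s).
  - exact: reg_coef_continuous.
  - apply: continuous_subspaceT => s; exact: is_derive_continuous (DG s).
  - exact: cvg_cst.
have W2 t : 0 <= t <= T -> W t = W (T / 2).
  move=> tT; apply/eqP; rewrite -subr_eq0; apply/eqP.
  apply: (@within_continuous_eq0 R 0 T (fun t => W t - W (T / 2))) => //.
    by move=> s; apply: cvgB; [exact: cW|exact: cvg_cst].
  move=> s /andP[s0 sT]; apply/eqP; rewrite subr_eq0; apply/eqP.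
  have [st|ts] := leP s (T / 2); first by apply: Wcst => //; lra.
  by rewrite (@Wcst (T / 2) s)//; lra.
move=> t tT.
have W0 : W 0 = \int[mu]_(x in `[- pi, pi]) (phi x * c x).
  rewrite /W mulr0 expR0 mul1r G0 mul0r subr0.
  apply: eq_Rintegral => x /set_mem; rewrite /= in_itv/= => xpi.
  by have [->] := uphi _ xpi.
rewrite -W0 (W2 0); last by rewrite lexx ltW.
by rewrite -(W2 t)// /W subrK.
Qed.

End Modes.

Lemma reg_fcoef_eq T eps phi psi u f u' f' k th sg t : 0 < T ->
  (forall x, mode k th (- x) = sg * mode k th x) ->
  regular_solution T eps phi psi u f -> regular_solution T eps phi psi u' f' ->
  0 <= t <= T -> fcoef (u ^~ t) k th = fcoef (u' ^~ t) k th.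
Proof.
move=> T0 sgE reg reg' tT.
have [G [G0 DG]] := exists_growth ((1 - sg * eps) * k%:R ^+ 2).
have TT : 0 <= T <= T by rewrite lexx ltW.
(* [G T] is positive, being T times an exponential; so the identity at t = T can be solved for the
   coefficient of [f]. *)
have GT : G T != 0.
  have [|s _] := @MVT_segment R G
    (fun s => expR ((1 - sg * eps) * k%:R ^+ 2 * s)) 0 T (ltW T0) (fun x _ => DG x).
    by apply: continuous_subspaceT => s; exact: is_derive_continuous (DG s).
  by rewrite G0 !subr0 => ->; rewrite gt_eqF// mulr_gt0// expR_gt0.
have H := reg_coef_identity T0 reg sgE G0 DG.
have H' := reg_coef_identity T0 reg' sgE G0 DG.
have psiE (v : R -> R -> R) g : regular_solution T eps phi psi v g ->
    \int[mu]_(x in `[- pi, pi]) (v x T * mode k th x) =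
    \int[mu]_(x in `[- pi, pi]) (psi x * mode k th x).
  move=> [_ [_ [_ [_ [_ [_ [vphi _]]]]]]].
  apply: eq_Rintegral => x /set_mem; rewrite /= in_itv/= => xpi.
  by have [_ ->] := vphi _ xpi.
have FF : \int[mu]_(x in `[- pi, pi]) (f x * mode k th x) =
    \int[mu]_(x in `[- pi, pi]) (f' x * mode k th x).
  have := H _ TT; have := H' _ TT; rewrite (psiE _ _ reg) (psiE _ _ reg') => -> /addrI.
  by move=> /(mulfI GT).
rewrite /fcoef; congr (_ * _).
have := H _ tT; rewrite FF -(H' _ tT) => /mulfI; apply.
by rewrite gt_eqF// expR_gt0.
Qed.

(** Only the shifts 0 and pi/2 have a parity, hence a mode equation; all other shifts follow from
    the addition formula. *)
Lemma fcoefE g k th : intg (- pi) pi g ->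
  fcoef g k th = cos th * fcoef g k 0 + sin th * fcoef g k (pi / 2).
Proof.
move=> Ig; rewrite /fcoef mulrCA [sin th * _]mulrCA -mulrDr; congr (_ * _).
have I0 := intgM_mode k 0 Ig; have I1 := intgM_mode k (pi / 2) Ig.
rewrite -!RintegralZl// -RintegralD//; [|exact: intgZ..].
by apply: eq_Rintegral => x _; rewrite modeE; ring.
Qed.

Lemma fcoefB g g' k th : intg (- pi) pi g -> intg (- pi) pi g' ->
  fcoef (fun x => g x - g' x) k th = fcoef g k th - fcoef g' k th.
Proof.
move=> Ig Ig'; rewrite /fcoef -mulrBr; congr (_ * _).
rewrite -RintegralB//; [|exact: intgM_mode..].
by apply: eq_Rintegral => x _; rewrite mulrBl.
Qed.

Lemma mode_even k x : mode k 0 (- x) = 1 * mode k 0 x.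
Proof. by rewrite modeN oppr0 mul1r. Qed.

Lemma mode_odd k x : mode k (pi / 2) (- x) = -1 * mode k (pi / 2) x.
Proof. by rewrite !mode_sin mulrN sinN mulN1r. Qed.

Lemma regular_solution_unique T eps phi psi u f u' f' : 0 < T ->
  regular_solution T eps phi psi u f -> regular_solution T eps phi psi u' f' ->
  (forall x t, - pi <= x <= pi -> 0 <= t <= T -> u x t = u' x t) /\
  (forall x, - pi <= x <= pi -> f x = f' x).
Proof.
move=> T0 reg reg'; have pi0 := pi_gt0 R.
have uu x t : - pi <= x <= pi -> 0 <= t <= T -> u x t = u' x t.
  move=> xpi tT; apply/eqP; rewrite -subr_eq0; apply/eqP.
  have cu := reg_slice reg tT; have cu' := reg_slice reg' tT.
  have Iu : intg (- pi) pi (u ^~ t) := continuous_integrable cu.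
  have Iu' : intg (- pi) pi (u' ^~ t) := continuous_integrable cu'.
  apply: (@fourier_unique R (fun x => u x t - u' x t)) => //.
    by move=> y; apply: cvgB; [exact: cu|exact: cu'].
  move=> k th; rewrite fcoefB// (fcoefE k th Iu) (fcoefE k th Iu').
  rewrite (reg_fcoef_eq T0 (mode_even k) reg reg' tT).
  by rewrite (reg_fcoef_eq T0 (mode_odd k) reg reg' tT) subrr.
split=> // x xpi; apply/eqP; rewrite -subr_eq0; apply/eqP.
case: (reg) => cf [_ [_ [_ [_ [eqn _]]]]].
case: (reg') => cf' [_ [_ [_ [_ [eqn' _]]]]].
apply: (@within_continuous_eq0 R (- pi) pi (fun x => f x - f' x)) => //; first lra.
  by move=> y; apply: cvgB; [exact: cf|exact: cf'].
move=> {xpi}x xpi.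
(* Once u = u', the equation at one interior time, here T/2, gives f = f' inside the interval;
   continuity has already reduced the claim to that case. *)
have Tt : 0 < T / 2 < T by apply/andP; split; lra.
have O y : - pi < y < pi -> Omega T (y, T / 2) by move=> ypi; apply/OmegaP.
have near_pi (y : R) : - pi < y < pi -> \forall z \near y, - pi < z < pi.
  move=> /andP[ya yb]; near=> z; apply/andP; split; near: z.
  - exact: lt_nbhsr.
  - exact: lt_nbhsl.
have pdxE y : - pi < y < pi -> pdx u y (T / 2) = pdx u' y (T / 2).
  move=> ypi; rewrite /pdx !derive1E; apply: near_eq_derive.
  have := near_pi y ypi; apply: filterS => z /andP[? ?].
  by apply: uu; apply/andP; split; lra.
have pdxxE y : - pi < y < pi -> pdxx u y (T / 2) = pdxx u' y (T / 2).
  move=> ypi; rewrite /pdxx !derive1E; apply: near_eq_derive.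
  by have := near_pi y ypi; apply: filterS => z; exact: pdxE.
have pdtE : pdt u x (T / 2) = pdt u' x (T / 2).
  rewrite /pdt !derive1E; apply: near_eq_derive; near=> s.
  case/andP: xpi => ? ?; apply: uu; first by apply/andP; split; lra.
  have s0 : 0 < s by near: s; apply: lt_nbhsr; lra.
  have sT : s < T by near: s; apply: lt_nbhsl; lra.
  by rewrite !ltW.
have xpi' : - pi < - x < pi by case/andP: xpi => ? ?; apply/andP; split; lra.
by rewrite -(eqn _ _ (O _ xpi)) -(eqn' _ _ (O _ xpi)) pdtE !pdxxE// subrr.
Unshelve. all: by end_near. Qed.

End Uniqueness.

(** * The solution series of one parity and its derivatives *)

Section ModeSeries.
Variable R : realType.
Local Notation mu := (@lebesgue_measure R).
Variables (kap th : R) (b : nat -> R).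
Implicit Types x t : R.
Hypotheses (kap0 : 0 < kap)
  (sb : cvgn (series (fun n => n.+1%:R ^+ 2 * `|b n|))).

Let E n (t : R) := expR (- kap * n.+1%:R ^+ 2 * t).

(** Index [n] stands for the frequency n + 1, and [kap] for 1 - eps or 1 + eps. The companions are
    the formal derivatives and the source. Summability of k^2 |b_k| dominates them all for t >= 0,
    where the exponentials are at most 1. *)
Definition heat (x t : R) n := (1 - E n t) * b n * mode n.+1 th x.
Definition heat_x (x t : R) n :=
  (1 - E n t) * b n * (- n.+1%:R * mode n.+1 (th + pi / 2) x).
Definition heat_xx (x t : R) n :=
  - n.+1%:R ^+ 2 * ((1 - E n t) * b n * mode n.+1 th x).
Definition heat_t (x t : R) n :=
  kap * n.+1%:R ^+ 2 * E n t * b n * mode n.+1 th x.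
Definition heat_src (x : R) n := kap * n.+1%:R ^+ 2 * b n * mode n.+1 th x.

Let M n := n.+1%:R ^+ 2 * `|b n|.

Let E_itv n t : 0 <= t -> 0 <= E n t <= 1.
Proof.
move=> t0; rewrite expR_ge0/= -expR0 ler_expR mulNr mulNr oppr_le0.
by rewrite mulr_ge0// mulr_ge0 ?sqr_ge0// ltW.
Qed.

Let oneBE_le n t : 0 <= t -> `|1 - E n t| <= 1.
Proof. by move=> /(E_itv n)/andP[? ?]; rewrite ger0_norm; lra. Qed.

Let natS_ge1 n : 1 <= n.+1%:R :> R. Proof. by rewrite ler1n. Qed.

Lemma heat_le x t n : 0 <= t -> `|heat x t n| <= M n.
Proof.
move=> t0; rewrite /heat /M !normrM.
apply: le_trans (_ : _ <= 1 * `|b n| * 1) _.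
  by rewrite ler_pM ?mulr_ge0 ?mode_le1// ler_wpM2r// oneBE_le.
rewrite mul1r mulr1 -[leLHS]mul1r ler_wpM2r// exprn_ege1//; exact: natS_ge1.
Qed.

Lemma heat_x_le x t n : 0 <= t -> `|heat_x x t n| <= M n.
Proof.
move=> t0; rewrite /heat_x /M !normrM normrN normr_nat.
apply: le_trans (_ : _ <= 1 * `|b n| * (n.+1%:R * 1)) _.
  by rewrite ler_pM ?mulr_ge0// ?ler_wpM2r ?oneBE_le// ler_wpM2l// mode_le1.
rewrite mul1r mulr1 mulrC ler_wpM2r// expr2 ler_peMl//; exact: natS_ge1.
Qed.

Lemma heat_xx_le x t n : 0 <= t -> `|heat_xx x t n| <= M n.
Proof.
move=> t0; rewrite /heat_xx /M !normrM normrN normrX normr_nat ler_wpM2l ?sqr_ge0//.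
apply: le_trans (_ : _ <= 1 * `|b n| * 1) _; last by rewrite mul1r mulr1.
by rewrite ler_pM ?mulr_ge0 ?mode_le1// ler_wpM2r// oneBE_le.
Qed.

Lemma heat_src_le x n : `|heat_src x n| <= kap * M n.
Proof.
have k0 : 0 <= kap * n.+1%:R ^+ 2 by rewrite mulr_ge0 ?sqr_ge0// ltW.
rewrite /heat_src /M 2!normrM (ger0_norm k0) [leRHS]mulrA.
by rewrite ler_piMr ?mode_le1// mulr_ge0.
Qed.

Lemma heat_t_le x t n : 0 <= t -> `|heat_t x t n| <= kap * M n.
Proof.
move=> t0; have /andP[E0 E1] := E_itv n t0.
rewrite (_ : heat_t x t n = E n t * heat_src x n); last by rewrite /heat_t /heat_src; ring.
rewrite normrM (ger0_norm E0); apply: le_trans (heat_src_le x n).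
by rewrite ler_piMl.
Qed.

Let cM : cvgn (series M). Proof. exact: sb. Qed.

Let ckM : cvgn (series (fun n => kap * M n)).
Proof.
have [H _] := limn_series_lin kap 0 cM cM.
by move: H; under eq_fun do rewrite mul0r addr0.
Qed.

Lemma heat_cvg x t : 0 <= t -> cvgn (series (heat x t)).
Proof. by move=> t0; apply: series_abs_cvg cM => n; exact: heat_le. Qed.

Lemma heat_x_cvg x t : 0 <= t -> cvgn (series (heat_x x t)).
Proof. by move=> t0; apply: series_abs_cvg cM => n; exact: heat_x_le. Qed.

Lemma heat_xx_cvg x t : 0 <= t -> cvgn (series (heat_xx x t)).
Proof. by move=> t0; apply: series_abs_cvg cM => n; exact: heat_xx_le. Qed.

Lemma heat_t_cvg x t : 0 <= t -> cvgn (series (heat_t x t)).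
Proof. by move=> t0; apply: series_abs_cvg ckM => n; exact: heat_t_le. Qed.

Lemma heat_src_cvg x : cvgn (series (heat_src x)).
Proof. by apply: series_abs_cvg ckM => n; exact: heat_src_le. Qed.

Lemma is_derive_heat_x x t : 0 <= t ->
  is_derive x 1 (fun y => limn (series (heat y t))) (limn (series (heat_x x t))).
Proof.
move=> t0.
have xx : x - 1 < x < x + 1 by apply/andP; split; lra.
have D n y : x - 1 < y < x + 1 -> is_derive y 1 (fun y => heat y t n) (heat_x y t n).
  by move=> _; exact: is_deriveZ (is_derive_mode n.+1 th y).
have B n y : x - 1 < y < x + 1 -> `|heat_x y t n| <= M n.
  by move=> _; exact: heat_x_le.
have C y : x - 1 < y < x + 1 -> cvgn (series (fun n => heat y t n)).
  by move=> _; exact: heat_cvg.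
exact: (is_derive_series xx D B cM C).
Qed.

Lemma is_derive_heat_xx x t : 0 <= t ->
  is_derive x 1 (fun y => limn (series (heat_x y t))) (limn (series (heat_xx x t))).
Proof.
move=> t0.
have xx : x - 1 < x < x + 1 by apply/andP; split; lra.
have D n y : x - 1 < y < x + 1 -> is_derive y 1 (fun y => heat_x y t n) (heat_xx y t n).
  move=> _.
  have := is_deriveZ ((1 - E n t) * b n)
    (is_deriveZ (- n.+1%:R) (is_derive_mode n.+1 (th + pi / 2) y)).
  move/is_derive_eq; apply.
  by rewrite mode_oppth /heat_xx /GRing.scale/=; ring.
have B n y : x - 1 < y < x + 1 -> `|heat_xx y t n| <= M n.
  by move=> _; exact: heat_xx_le.
have C y : x - 1 < y < x + 1 -> cvgn (series (fun n => heat_x y t n)).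
  by move=> _; exact: heat_x_cvg.
exact: (is_derive_series xx D B cM C).
Qed.

Lemma is_derive_heat_t x t : 0 < t ->
  is_derive t 1 (fun s => limn (series (heat x s))) (limn (series (heat_t x t))).
Proof.
move=> t0.
(* The neighbourhood starts at 0, because the exponentials are bounded by 1 only for nonnegative
   times. *)
have tt : 0 < t < t + 1 by apply/andP; split; lra.
have D n s : 0 < s < t + 1 -> is_derive s 1 (fun s => heat x s n) (heat_t x s n).
  move=> _.
  have D1 := is_deriveB (is_derive_cst (1 : R) s 1)
    (is_derive_expR_lin (- kap * n.+1%:R ^+ 2) s).
  have := is_deriveM (is_deriveM D1 (is_derive_cst (b n) s 1))
    (is_derive_cst (mode n.+1 th x) s 1).
  move/is_derive_eq; apply.
  by rewrite !scaler0 !add0r /heat_t /GRing.scale/= -/(E n s); ring.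
have B n s : 0 < s < t + 1 -> `|heat_t x s n| <= kap * M n.
  by move=> /andP[s0 _]; apply: heat_t_le; exact: ltW.
have C s : 0 < s < t + 1 -> cvgn (series (fun n => heat x s n)).
  by move=> /andP[s0 _]; apply: heat_cvg; exact: ltW.
exact: (is_derive_series tt D B ckM C).
Qed.

Let cfst (g : R -> R) : continuous g -> continuous (fun q : R * R => g q.1).
Proof. by move=> cg q; apply: continuous_comp; [exact: cvg_fst|exact: cg]. Qed.

Let csnd (g : R -> R) : continuous g -> continuous (fun q : R * R => g q.2).
Proof. by move=> cg q; apply: continuous_comp; [exact: cvg_snd|exact: cg]. Qed.

Let cE n : continuous (E n).
Proof. by move=> t; exact: is_derive_continuous (is_derive_expR_lin _ _). Qed.

Let coneBE n : continuous (fun q : R * R => (1 - E n q.2) * b n).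
Proof.
move=> q; apply: cvgM; last exact: cvg_cst.
by apply: cvgB; [exact: cvg_cst|exact: (csnd (@cE n))].
Qed.

Let K : set (R * R) := [set q | 0 <= q.2].

Lemma heat_continuous :
  {within K, continuous (fun q : R * R => limn (series (heat q.1 q.2)))}.
Proof.
apply: (@within_continuous_series R _ K (fun n q => heat q.1 q.2 n) M) => //.
- move=> n q; apply: cvgM; first exact: coneBE.
  exact: (cfst (@continuous_mode R n.+1 th)).
- by move=> n q; exact: heat_le.
Qed.

Lemma heat_x_continuous :
  {within K, continuous (fun q : R * R => limn (series (heat_x q.1 q.2)))}.
Proof.
apply: (@within_continuous_series R _ K (fun n q => heat_x q.1 q.2 n) M) => //.
- move=> n q; apply: cvgM; first exact: coneBE.
  apply: cvgM; first exact: cvg_cst.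
  exact: (cfst (@continuous_mode R n.+1 (th + pi / 2))).
- by move=> n q; exact: heat_x_le.
Qed.

Lemma heat_xx_continuous :
  {within K, continuous (fun q : R * R => limn (series (heat_xx q.1 q.2)))}.
Proof.
apply: (@within_continuous_series R _ K (fun n q => heat_xx q.1 q.2 n) M) => //.
- move=> n q; apply: cvgM; first exact: cvg_cst.
  apply: cvgM; first exact: coneBE.
  exact: (cfst (@continuous_mode R n.+1 th)).
- by move=> n q; exact: heat_xx_le.
Qed.

Lemma heat_t_continuous :
  {within K, continuous (fun q : R * R => limn (series (heat_t q.1 q.2)))}.
Proof.
apply: (@within_continuous_series R _ K (fun n q => heat_t q.1 q.2 n) (fun n => kap * M n)) => //.
- move=> n q; apply: cvgM; last exact: (cfst (@continuous_mode R n.+1 th)).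
  apply: cvgM; last exact: cvg_cst.
  by apply: cvgM; [exact: cvg_cst|exact: (csnd (@cE n))].
- by move=> n q; exact: heat_t_le.
Qed.

Lemma heat_src_continuous a c :
  {within `[a, c], continuous (fun x => limn (series (heat_src x)))}.
Proof.
apply: (@within_continuous_series R _ _ (fun n x => heat_src x n) (fun n => kap * M n)) => //.
- by move=> n x; apply: cvgM; [exact: cvg_cst|exact: continuous_mode].
- by move=> n x _; exact: heat_src_le.
Qed.

Lemma heat_0 x : limn (series (heat x 0)) = 0.
Proof.
rewrite (_ : series _ = fun=> 0); first exact: lim_cst.
apply/funext => n; rewrite /series /= big1// => i _.
by rewrite /heat /E mulr0 expR0 subrr !mul0r.
Qed.

Lemma heat_per t : limn (series (heat (- pi) t)) = limn (series (heat pi t)).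
Proof. by congr (limn (series _)); apply/funext => n; rewrite /heat mode_periodic. Qed.

Lemma heat_x_per t : limn (series (heat_x (- pi) t)) = limn (series (heat_x pi t)).
Proof. by congr (limn (series _)); apply/funext => n; rewrite /heat_x mode_periodic. Qed.

(** By parity the three terms on the left combine into kap k^2 E + kap k^2 (1 - E), so the
    exponential cancels and a source constant in time remains. *)
Lemma heat_equation eps sg x t : 0 <= t -> kap = 1 - sg * eps ->
  (forall n x, mode n.+1 th (- x) = sg * mode n.+1 th x) ->
  limn (series (heat_t x t)) - limn (series (heat_xx x t))
    + eps * limn (series (heat_xx (- x) t)) = limn (series (heat_src x)).
Proof.
move=> t0 kapE sgE.
have c1 : cvgn (series (heat_t x t)) by exact: heat_t_cvg.
have c2 : cvgn (series (heat_xx x t)) by exact: heat_xx_cvg.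
have -> : heat_xx (- x) t = (fun n => sg * heat_xx x t n + 0 * heat_xx x t n).
  by apply/funext => n; rewrite /heat_xx sgE; ring.
have [_ ->] := limn_series_lin sg 0 c2 c2.
have -> : heat_src x = (fun n => 1 * heat_t x t n + (-1 + eps * sg) * heat_xx x t n).
  by apply/funext => n; rewrite /heat_src /heat_t /heat_xx kapE; ring.
have [_ ->] := limn_series_lin 1 (-1 + eps * sg) c1 c2.
ring.
Qed.

End ModeSeries.

(** * Coefficients of a mode series and of the third derivative *)

Section SeriesCoefficients.
Variable R : realType.
Local Notation mu := (@lebesgue_measure R).
Implicit Types (th x : R) (g : R -> R) (beta : nat -> R).

Lemma series_pick beta (c : R) k N : (k < N)%N ->
  series (fun n => beta n * ((n.+1 == k)%:R * pi * c)) N =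
  (if k is k'.+1 then beta k' else 0) * (pi * c).
Proof.
case: k => [|k] kN; rewrite /series /=.
  by rewrite [RHS]mul0r big1// => i _; rewrite !mul0r mulr0.
have {}kN : (k < N)%N by exact: ltnW.
rewrite big_mkord (bigD1 (Ordinal kN))//= eqxx big1 ?addr0 ?mul1r// => i ik.
by rewrite eqSS (_ : (nat_of_ord i == k) = false) ?mul0r ?mulr0//; exact/negbTE.
Qed.

(** Partial sums are bounded by the sum of the |beta_n|, so the series may be integrated term by
    term; orthogonality keeps at most the term of frequency [k], which has index k - 1. *)
Lemma fcoef_mode_series th th' beta k : cvgn (series (fun n => `|beta n|)) ->
  fcoef (fun x => limn (series (fun n => beta n * mode n.+1 th x))) k th' =
  (if k is k'.+1 then beta k' else 0) * cos (th - th').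
Proof.
move=> sb; have pin0 : pi != 0 :> R by rewrite gt_eqF// pi_gt0.
pose w n x := beta n * mode n.+1 th x.
have wle n x : `|w n x| <= `|beta n| by rewrite normrM ler_piMr// mode_le1.
have wc n : continuous (w n).
  by move=> x; apply: cvgM; [exact: cvg_cst|exact: continuous_mode].
have cN N : continuous (fun x => series (w ^~ x) N).
  move=> x; apply: (@cvg_series_finite R _ (nbhs x) _ (fun n x => w n x) (fun n => w n x) N).
  by move=> n; exact: wc.
have cS : {within `[- pi, pi], continuous (fun x => limn (series (w ^~ x)))}.
  by apply: (@within_continuous_series R _ _ w (fun n => `|beta n|)).
have bnd N x : `|series (w ^~ x) N| <= limn (series (fun n => `|beta n|)).
  apply: le_trans (ler_norm_sum _ _ _) _.
  apply: le_trans (ler_sum _ (fun i _ => wle i x)) _.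
  apply: nondecreasing_cvgn_le => //.
  by apply/nondecreasing_seqP => n; rewrite seriesS lerDr.
have IN N : intg (- pi) pi (fun x => series (w ^~ x) N * mode k th' x).
  by apply: intgM_mode; apply: continuous_intg; exact: cN.
have lim : (fun N => \int[mu]_(x in `[- pi, pi]) (series (w ^~ x) N * mode k th' x))
    @ \oo --> \int[mu]_(x in `[- pi, pi]) (limn (series (w ^~ x)) * mode k th' x).
  apply: (@Rintegral_cvg_dominated R _ _ _ _ (fun=> limn (series (fun n => `|beta n|)))) => //.
  - by apply: intgM_mode; exact: continuous_integrable.
  - by apply: continuous_intg => x; exact: cvg_cst.
  - move=> x _; apply: cvgM; last exact: cvg_cst.
    exact: series_abs_cvg sb.
  - move=> N x _; rewrite normrM -[leRHS]mulr1 ler_pM// mode_le1//.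
have IE N : \int[mu]_(x in `[- pi, pi]) (series (w ^~ x) N * mode k th' x) =
    series (fun n => beta n * ((n.+1 == k)%:R * pi * cos (th - th'))) N.
  elim: N => [|N IH].
    rewrite /series /= big_geq//; under eq_Rintegral do rewrite big_geq// mul0r.
    by rewrite Rintegral_cst_pi mul0r.
  rewrite seriesS -IH -(Rintegral_mode_mul k th th' (ltn0Sn N)) -RintegralZl//; last first.
    by apply: intgM_mode; exact: intg_mode.
  have I2 : intg (- pi) pi (fun x => beta N * (mode N.+1 th x * mode k th' x)).
    by apply: intgZ; apply: intgM_mode; exact: intg_mode.
  rewrite addrC -(RintegralD _ (IN N) I2)//.
  by apply: eq_Rintegral => x _; rewrite seriesS mulrDl /w mulrA addrC.
have lim2 : (fun N => \int[mu]_(x in `[- pi, pi]) (series (w ^~ x) N * mode k th' x))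
    @ \oo --> (if k is k'.+1 then beta k' else 0) * (pi * cos (th - th')).
  (* Once N > k the integral of the partial sum no longer depends on [N]. *)
  apply: cvg_near_cst; apply: filterS (nbhs_infty_gt k) => N kN.
  by rewrite IE series_pick.
apply: (mulfI pin0); rewrite /fcoef mulrA mulfV// mul1r mulrCA.
by symmetry; apply: (cvg_unique _ lim2 lim).
Qed.

Lemma fcoef_cst (m : R) k th : fcoef (fun=> m) k th = (k == 0%N)%:R * (2 * m * cos th).
Proof.
have pin0 : pi != 0 :> R by rewrite gt_eqF// pi_gt0.
rewrite /fcoef RintegralZl//; last exact: intg_mode.
case: k => [|k]; last by rewrite Rintegral_mode// mulr0 mulr0 mul0r.
under eq_Rintegral do rewrite mode0.
by rewrite Rintegral_cst_pi/=; move: pi pin0 => p p0; field.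
Qed.

Lemma fcoef0 g th : intg (- pi) pi g -> fcoef g 0 th = 2 * mean0 g * cos th.
Proof.
move=> Ig; have pin0 : pi != 0 :> R by rewrite gt_eqF// pi_gt0.
rewrite /fcoef /mean0; under eq_Rintegral do rewrite mode0.
by rewrite RintegralZr//; move: (Rintegral _ _ _) => I; move: pi pin0 => p p0; field.
Qed.

Lemma fcoefD g g' k th : intg (- pi) pi g -> intg (- pi) pi g' ->
  fcoef (fun x => g x + g' x) k th = fcoef g k th + fcoef g' k th.
Proof.
move=> Ig Ig'; rewrite /fcoef -mulrDr; congr (_ * _).
rewrite -RintegralD//; [|exact: intgM_mode..].
by apply: eq_Rintegral => x _; rewrite mulrDl.
Qed.

(** Integration by parts; the boundary terms cancel because [g] and the mode are both periodic. *)
Lemma deriv_within_fcoef g g1 k th :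
  (forall x, - pi <= x <= pi -> deriv_within (- pi) pi g x (g1 x)) ->
  {within `[- pi, pi], continuous g1} -> g (- pi) = g pi ->
  k%:R * fcoef g k (th + pi / 2) = fcoef g1 k th.
Proof.
move=> Dg cg1 per; have pi0 := pi_gt0 R.
have lt_pi : - pi < pi :> R by lra.
have cg := deriv_within_within_continuous Dg.
have := @Rintegral_by_parts_within R _ _ g g1 (mode k th)
  (fun x => - k%:R * mode k (th + pi / 2) x) lt_pi cg1 Dg.
have cm : {within `[- pi, pi], continuous (fun x => - k%:R * mode k (th + pi / 2) x)}.
  apply: continuous_subspaceT => x.
  by apply: cvgM; [exact: cvg_cst|exact: continuous_mode].
move=> /(_ cm (fun x _ => is_derive_deriv_within _ _ (is_derive_mode k th x))).
rewrite per mode_periodic subrr sub0r => H.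
rewrite /fcoef mulrCA; congr (_ * _); apply/eqP; rewrite -eqr_opp -H -mulNr.
rewrite -RintegralZl//; last by apply: intgM_mode; exact: continuous_integrable.
by apply/eqP; apply: eq_Rintegral => x _; ring.
Qed.

Lemma fcoef_oppth g k th : intg (- pi) pi g ->
  fcoef g k (th + pi / 2 + pi / 2) = - fcoef g k th.
Proof.
move=> Ig; rewrite /fcoef -mulrN; congr (_ * _).
rewrite -[- Rintegral _ _ _]mulN1r -RintegralZl//; last exact: intgM_mode.
by apply: eq_Rintegral => x _; rewrite mode_oppth mulN1r mulrN.
Qed.

Lemma coef_cosE g k : coef_cos g k = fcoef g k 0.
Proof.
by rewrite /coef_cos /fcoef; congr (_ * _); apply: eq_Rintegral => x _; rewrite mode_cos.
Qed.

Lemma coef_sinE g k : coef_sin g k = fcoef g k (pi / 2).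
Proof.
by rewrite /coef_sin /fcoef; congr (_ * _); apply: eq_Rintegral => x _; rewrite mode_sin.
Qed.

Section ThirdDerivative.
Variables g g1 g2 g3 : R -> R.
Hypotheses (gC2 : C2_on (- pi) pi g g1 g2) (g3w : weak_deriv_L2 (- pi) pi g2 g3)
  (per0 : g (- pi) = g pi) (per1 : g1 (- pi) = g1 pi) (per2 : g2 (- pi) = g2 pi).

Lemma C2_intg : intg (- pi) pi g.
Proof.
case: gC2 => D _; apply: continuous_integrable.
exact: deriv_within_within_continuous D.
Qed.

(** Two classical integrations by parts and a weak one. The total shift 3 pi / 2 exchanges sine and
    cosine coefficients, with a sign in one direction only. *)
Lemma fcoef_third k th :
  fcoef g3 k th = k%:R ^+ 3 * fcoef g k (th + pi / 2 + pi / 2 + pi / 2).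
Proof.
case: gC2 => D [D1 cg2]; have cg1 := deriv_within_within_continuous D1.
rewrite -(weak_deriv_mode k th cg2 per2 g3w) -(deriv_within_fcoef k _ D1 cg2 per1).
by rewrite -(deriv_within_fcoef k _ D cg1 per0); ring.
Qed.

Lemma coef_cos_third k : coef_cos g3 k = - (k%:R ^+ 3 * coef_sin g k).
Proof.
rewrite coef_cosE coef_sinE fcoef_third (addrC 0) -addrA addrA [in LHS](_ : pi / 2 + 0 = pi / 2).
  by rewrite fcoef_oppth ?mulrN//; exact: C2_intg.
by rewrite addr0.
Qed.

Lemma coef_sin_third k : coef_sin g3 k = k%:R ^+ 3 * coef_cos g k.
Proof.
rewrite coef_cosE coef_sinE fcoef_third -[X in X + _ + _ + _]add0r.
by rewrite fcoef_oppth ?fcoef_oppth ?opprK//; exact: C2_intg.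
Qed.

(** By |a|/k <= (a^2 + 1/k^2) / 2, from Bessel's inequality for [g3] and the convergence of the sum
    of 1/k^2. *)
Lemma third_coef_summable th : cvgn (series (fun n => `|fcoef g3 n.+1 th| / n.+1%:R)).
Proof.
have [I3 I32] := weak_deriv_intg g3w.
have c1 : cvgn (series (fun n => fcoef g3 n.+1 th ^+ 2)).
  apply: ge0_series_bounded_cvg => [n|n]; first exact: sqr_ge0.
  by rewrite /series /= big_mkord; exact: bessel.
have [H _] := limn_series_lin 2^-1 2^-1 c1 (@series_inv_sqr_cvg R).
apply: series_abs_cvg H => n; rewrite normrM normr_id normfV normr_nat.
have := sqr_ge0 (`|fcoef g3 n.+1 th| - n.+1%:R^-1).
rewrite sqrrB real_normK ?num_real// exprVn.
by move: (`|_| / _) (_ ^+ 2) (_ ^- 2) => x y z; rewrite -mulr_natr; lra.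
Qed.

End ThirdDerivative.
End SeriesCoefficients.

(** * Existence: the explicit series is a regular solution *)

Section Existence.
Variable R : realType.
Implicit Types x t : R.
Local Notation mu := (@lebesgue_measure R).

(** The denominator normalises the time factor 1 - exp (-kap k^2 t) of the mode so that it equals 1
    at t = T. *)
Definition damped (kap T : R) (a : nat -> R) n :=
  a n / ((1 - expR (- kap * n.+1%:R ^+ 2 * T)) * n.+1%:R ^+ 3).

Lemma one_sub_expR_gt0 (kap T : R) n : 0 < kap -> 0 < T ->
  0 < 1 - expR (- kap * n.+1%:R ^+ 2 * T).
Proof.
move=> k0 T0; rewrite subr_gt0 expR_lt1 mulNr mulNr oppr_lt0.
by rewrite mulr_gt0// mulr_gt0// exprn_gt0.
Qed.

Lemma damped_summable (kap T : R) (a : nat -> R) : 0 < kap -> 0 < T ->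
  cvgn (series (fun n => `|a n| / n.+1%:R)) ->
  cvgn (series (fun n => n.+1%:R ^+ 2 * `|damped kap T a n|)).
Proof.
(* [q] is the time factor for k = 1 at t = T, the smallest of all; the weight k^2 against k^3 leaves
   |a_k| / k. *)
move=> k0 T0 ca; pose q := 1 - expR (- kap * T).
have q0 : 0 < q by have := one_sub_expR_gt0 0 k0 T0; rewrite expr1n mulr1.
have [H _] := limn_series_lin q^-1 0 ca ca.
apply: series_abs_cvg H => n; rewrite mul0r addr0.
have D0 := one_sub_expR_gt0 n k0 T0.
have qD : q <= 1 - expR (- kap * n.+1%:R ^+ 2 * T).
  rewrite lerD2l lerN2 ler_expR !mulNr lerN2 -mulrA ler_pM2l// ler_peMl ?(ltW T0)//.
  by rewrite exprn_ege1// ler1n.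
rewrite /damped; move: (1 - _) D0 qD => D D0 qD.
have n0 : 0 < n.+1%:R :> R by [].
move: (n.+1%:R) n0 => k kk0.
rewrite ger0_norm; last by rewrite mulr_ge0// sqr_ge0.
rewrite normrM (ger0_norm (_ : 0 <= (D * k ^+ 3)^-1)); last first.
  by rewrite invr_ge0 mulr_ge0 ?exprn_ge0// ltW.
rewrite (_ : _ * _ = D^-1 * (`|a n| / k)); last by field; rewrite !gt_eqF.
by apply: ler_wpM2r; [rewrite divr_ge0// ltW|rewrite lef_pV2].
Qed.

Variables (T eps : R) (phi phi1 phi2 phi3 psi psi1 psi2 psi3 : R -> R).
Hypotheses (T0 : 0 < T) (eps1 : `|eps| < 1).
Hypotheses (phiC2 : C2_on (- pi) pi phi phi1 phi2)
  (psiC2 : C2_on (- pi) pi psi psi1 psi2)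
  (phi3w : weak_deriv_L2 (- pi) pi phi2 phi3)
  (psi3w : weak_deriv_L2 (- pi) pi psi2 psi3)
  (phi_per : phi (- pi) = phi pi) (phi1_per : phi1 (- pi) = phi1 pi)
  (phi2_per : phi2 (- pi) = phi2 pi) (psi_per : psi (- pi) = psi pi)
  (psi1_per : psi1 (- pi) = psi1 pi) (psi2_per : psi2 (- pi) = psi2 pi).

Let kc := 1 - eps.
Let ks := 1 + eps.
Let ac n := coef_sin phi3 n.+1 - coef_sin psi3 n.+1.
Let as_ n := coef_cos phi3 n.+1 - coef_cos psi3 n.+1.
Let bc := damped kc T ac.
Let bs := damped ks T as_.
Let m := mean0 psi - mean0 phi.

Let kc0 : 0 < kc. Proof. by move: eps1; rewrite ltr_norml /kc => /andP[? ?]; lra. Qed.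
Let ks0 : 0 < ks. Proof. by move: eps1; rewrite ltr_norml /ks => /andP[? ?]; lra. Qed.

Let diff_summable th : cvgn (series (fun n =>
  `|fcoef phi3 n.+1 th - fcoef psi3 n.+1 th| / n.+1%:R)).
Proof.
have [H _] := limn_series_lin 1 1 (third_coef_summable (th := th) phi3w)
  (third_coef_summable (th := th) psi3w).
apply: series_abs_cvg H => n; rewrite !mul1r -mulrDl ger0_norm ?divr_ge0//.
by rewrite ler_wpM2r ?invr_ge0// ler_normB.
Qed.

Let ac_summable : cvgn (series (fun n => `|ac n| / n.+1%:R)).
Proof.
rewrite (_ : (fun n => _) = fun n =>
  `|fcoef phi3 n.+1 (pi / 2) - fcoef psi3 n.+1 (pi / 2)| / n.+1%:R).
  exact: diff_summable.
by apply/funext => n; rewrite /ac !coef_sinE.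
Qed.

Let as_summable : cvgn (series (fun n => `|as_ n| / n.+1%:R)).
Proof.
rewrite (_ : (fun n => _) = fun n =>
  `|fcoef phi3 n.+1 0 - fcoef psi3 n.+1 0| / n.+1%:R).
  exact: diff_summable.
by apply/funext => n; rewrite /as_ !coef_cosE.
Qed.

Let sbc := damped_summable kc0 T0 ac_summable.
Let sbs := damped_summable ks0 T0 as_summable.

Let u_cosE x t : u_cos_term T eps phi3 psi3 x t = heat kc 0 bc x t.
Proof.
apply/funext => n; rewrite /u_cos_term /heat mode_cos; congr (_ * _).
by rewrite -mulrA.
Qed.

Let u_sinE x t : u_sin_term T eps phi3 psi3 x t = heat ks (pi / 2) bs x t.
Proof.
apply/funext => n; rewrite /u_sin_term /heat mode_sin; congr (_ * _).
by rewrite -mulrA.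
Qed.

Let src_termE (kap c a : R) n : 0 < kap ->
  kap * a / ((1 - expR (- kap * n.+1%:R ^+ 2 * T)) * n.+1%:R) * c =
  kap * n.+1%:R ^+ 2 * (a / ((1 - expR (- kap * n.+1%:R ^+ 2 * T)) * n.+1%:R ^+ 3)) * c.
Proof.
move=> k0; have := one_sub_expR_gt0 n k0 T0.
have n0 : 0 < n.+1%:R :> R by [].
move: (1 - _) => D D0; move: (n.+1%:R) n0 => k kk0.
by field; rewrite !gt_eqF.
Qed.

Let f_cosE x : f_cos_term T eps phi3 psi3 x = heat_src kc 0 bc x.
Proof.
apply/funext => n; rewrite /f_cos_term /heat_src mode_cos.
exact: (src_termE _ (ac n) n kc0).
Qed.

Let f_sinE x : f_sin_term T eps phi3 psi3 x = heat_src ks (pi / 2) bs x.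
Proof.
apply/funext => n; rewrite /f_sin_term /heat_src mode_sin.
exact: (src_termE _ (as_ n) n ks0).
Qed.

Definition series_u x t := phi x + t / T * m
  - limn (series (u_cos_term T eps phi3 psi3 x t))
  + limn (series (u_sin_term T eps phi3 psi3 x t)).

Definition series_f x := - phi2 x + eps * phi2 (- x) + m / T
  - limn (series (f_cos_term T eps phi3 psi3 x))
  + limn (series (f_sin_term T eps phi3 psi3 x)).

Lemma u_cos_cvg x t : 0 <= t -> cvgn (series (u_cos_term T eps phi3 psi3 x t)).
Proof. by move=> t0; rewrite u_cosE; exact: heat_cvg. Qed.

Lemma u_sin_cvg x t : 0 <= t -> cvgn (series (u_sin_term T eps phi3 psi3 x t)).
Proof. by move=> t0; rewrite u_sinE; exact: heat_cvg. Qed.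

Lemma f_cos_cvg x : cvgn (series (f_cos_term T eps phi3 psi3 x)).
Proof. by rewrite f_cosE; exact: heat_src_cvg. Qed.

Lemma f_sin_cvg x : cvgn (series (f_sin_term T eps phi3 psi3 x)).
Proof. by rewrite f_sinE; exact: heat_src_cvg. Qed.

Let ux x t := phi1 x - limn (series (heat_x kc 0 bc x t))
  + limn (series (heat_x ks (pi / 2) bs x t)).
Let uxx x t := phi2 x - limn (series (heat_xx kc 0 bc x t))
  + limn (series (heat_xx ks (pi / 2) bs x t)).
Let ut x t := m / T - limn (series (heat_t kc 0 bc x t))
  + limn (series (heat_t ks (pi / 2) bs x t)).

Let series_uE x t : series_u x t = phi x + t / T * m
  - limn (series (heat kc 0 bc x t)) + limn (series (heat ks (pi / 2) bs x t)).
Proof. by rewrite /series_u u_cosE u_sinE. Qed.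

Let Dseries_u x t : - pi <= x <= pi -> 0 <= t ->
  deriv_within (- pi) pi (series_u ^~ t) x (ux x t).
Proof.
move=> xpi t0; case: phiC2 => D _.
have -> : series_u ^~ t = fun x => phi x + (t / T * m
    - limn (series (heat kc 0 bc x t)) + limn (series (heat ks (pi / 2) bs x t))).
  by apply/funext => y; rewrite series_uE !addrA.
rewrite /ux -addrA; apply: deriv_withinD; first exact: D.
apply: is_derive_deriv_within.
have := is_deriveD (is_deriveB (is_derive_cst (t / T * m) x 1)
  (is_derive_heat_x 0 kc0 sbc x t0)) (is_derive_heat_x (pi / 2) ks0 sbs x t0).
by move/is_derive_eq; apply; rewrite sub0r.
Qed.

Let Dux x t : - pi <= x <= pi -> 0 <= t ->
  deriv_within (- pi) pi (ux ^~ t) x (uxx x t).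
Proof.
move=> xpi t0; case: phiC2 => _ [D _].
have -> : ux ^~ t = fun x => phi1 x + (- limn (series (heat_x kc 0 bc x t))
    + limn (series (heat_x ks (pi / 2) bs x t))).
  by apply/funext => y; rewrite /ux !addrA.
rewrite /uxx -addrA; apply: deriv_withinD; first exact: D.
apply: is_derive_deriv_within.
exact: is_deriveD (is_deriveN (is_derive_heat_xx 0 kc0 sbc x t0))
  (is_derive_heat_xx (pi / 2) ks0 sbs x t0).
Qed.

Let Dt_series_u x t : 0 < t -> is_derive t 1 (series_u x) (ut x t).
Proof.
move=> t0.
have -> : series_u x = fun s => phi x + s * (m / T)
    - limn (series (heat kc 0 bc x s)) + limn (series (heat ks (pi / 2) bs x s)).
  by apply/funext => s; rewrite series_uE mulrAC mulrA.
have Dm := is_deriveM (is_derive_id t (1 : R)) (is_derive_cst (m / T) t 1).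
have := is_deriveD (is_deriveB (is_deriveD (is_derive_cst (phi x) t 1) Dm)
  (is_derive_heat_t 0 kc0 sbc x t0)) (is_derive_heat_t (pi / 2) ks0 sbs x t0).
by move/is_derive_eq; apply; rewrite scaler0 !add0r /GRing.scale/= mulr1.
Qed.

Let pdxE x t : Omega T (x, t) -> pdx series_u x t = ux x t.
Proof.
move=> /OmegaP[xpi /andP[t0 _]].
have xpi' : - pi <= x <= pi by case/andP: xpi => ? ?; rewrite !ltW.
have [_ <-] := deriv_within_is_derive xpi (Dseries_u xpi' (ltW t0)).
by rewrite /pdx derive1E.
Qed.

Let near_Omega (p : R * R) : Omega T p -> \forall q \near p, Omega T q.
Proof.
case: p => x t [xpi tT]; exists (`]- pi, pi[%classic, `]0, T[%classic) => //.
by split; apply: open_nbhs_nbhs; split => //; exact: interval_open.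
Qed.

Let Dpdx x t : Omega T (x, t) ->
  is_derive x 1 (fun y => pdx series_u y t) (uxx x t).
Proof.
move=> O; have /OmegaP[xpi /andP[t0 tT]] := O.
have xpi' : - pi <= x <= pi by case/andP: xpi => ? ?; rewrite !ltW.
apply: near_eq_is_derive (deriv_within_is_derive xpi (Dux xpi' (ltW t0))).
case/andP: xpi => xa xb; near=> y; rewrite pdxE//; apply/OmegaP.
rewrite t0 tT; split=> //; apply/andP; split; near: y.
- exact: lt_nbhsr.
- exact: lt_nbhsl.
Unshelve. all: by end_near. Qed.

Let within_fst (g : R -> R) : {within `[- pi, pi], continuous g} ->
  {within Omega_bar T, continuous (fun q : R * R => g q.1)}.
Proof.
move=> cg; apply/subspace_continuousP => -[x t] /Omega_barP[xpi tT].
apply/cvgrPdist_lt => e e0.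
have [d d0 Hd] := within_continuous_ball cg xpi e0.
rewrite near_withinE; apply/nbhs_ballP; exists d => // -[y s] [xy _] /Omega_barP[ypi _].
exact: Hd.
Qed.

Let bar_sub : Omega_bar T `<=` [set q : R * R | 0 <= q.2].
Proof. by move=> [x t] /Omega_barP[_ /andP[]]. Qed.

(** The partial derivatives coincide with the continuous series [ut], [ux], [uxx] only inside; since
    [Omega T] is open, continuity there is inherited. *)
Let interior_continuous (F G : R * R -> R) : {within Omega_bar T, continuous F} ->
  (forall p, Omega T p -> G p = F p) ->
  forall p, Omega T p -> {for p, continuous G}.
Proof.
move=> /subspace_continuousP cF GF p Op; rewrite /prop_for /continuous_at (GF p Op).
have Obar (q : R * R) : Omega T q -> Omega_bar T q.
  case: q => x t /OmegaP[/andP[? ?] /andP[? ?]]; apply/Omega_barP.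
  by split; apply/andP; split; exact: ltW.
apply/cvgrPdist_lt => e e0.
have /cvgrPdist_lt/(_ _ e0) := cF p (Obar p Op).
rewrite near_withinE => H; near=> q.
have Oq : Omega T q by near: q; exact: near_Omega.
have Hq : Omega_bar T q -> `|F p - F q| < e by near: q.
by rewrite (GF q Oq); apply: Hq; exact: Obar.
Unshelve. all: by end_near. Qed.

Let cu_bar : {within Omega_bar T, continuous (fun q : R * R => series_u q.1 q.2)}.
Proof.
have [D _] := phiC2.
have cphi := within_fst (deriv_within_within_continuous D).
have cc := continuous_subspaceW bar_sub (heat_continuous (th := 0) kc0 sbc).
have cs := continuous_subspaceW bar_sub (heat_continuous (th := pi / 2) ks0 sbs).
have ct : continuous (fun q : R * R => q.2 / T * m).
  by move=> q; apply: cvgM; [apply: cvgM; [exact: cvg_snd|exact: cvg_cst]|exact: cvg_cst].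
rewrite (_ : (fun q => _) = fun q : R * R => phi q.1 + q.2 / T * m
  - limn (series (heat kc 0 bc q.1 q.2)) + limn (series (heat ks (pi / 2) bs q.1 q.2))).
  move=> q; apply: cvgD; last exact: cs.
  apply: cvgB; last exact: cc.
  by apply: cvgD; [exact: cphi|exact: (continuous_subspaceT ct)].
by apply/funext => q; rewrite series_uE.
Qed.

Let cux_bar : {within Omega_bar T, continuous (fun q : R * R => ux q.1 q.2)}.
Proof.
have [_ [D _]] := phiC2.
have cphi := within_fst (deriv_within_within_continuous D).
have cc := continuous_subspaceW bar_sub (heat_x_continuous (th := 0) kc0 sbc).
have cs := continuous_subspaceW bar_sub (heat_x_continuous (th := pi / 2) ks0 sbs).
move=> q; apply: cvgD; last exact: cs.
by apply: cvgB; [exact: cphi|exact: cc].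
Qed.

Let cuxx_bar : {within Omega_bar T, continuous (fun q : R * R => uxx q.1 q.2)}.
Proof.
have [_ [_ cphi2]] := phiC2.
have cphi := within_fst cphi2.
have cc := continuous_subspaceW bar_sub (heat_xx_continuous (th := 0) kc0 sbc).
have cs := continuous_subspaceW bar_sub (heat_xx_continuous (th := pi / 2) ks0 sbs).
move=> q; apply: cvgD; last exact: cs.
by apply: cvgB; [exact: cphi|exact: cc].
Qed.

Let cut_bar : {within Omega_bar T, continuous (fun q : R * R => ut q.1 q.2)}.
Proof.
have cc := continuous_subspaceW bar_sub (heat_t_continuous (th := 0) kc0 sbc).
have cs := continuous_subspaceW bar_sub (heat_t_continuous (th := pi / 2) ks0 sbs).
move=> q; apply: cvgD; last exact: cs.
by apply: cvgB; [exact: cvg_cst|exact: cc].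
Qed.

(** [ac] and [as_] divided by k^3. The minus sign in [ds] is that of [coef_cos_third]. *)
Let dc n := coef_cos phi n.+1 - coef_cos psi n.+1.
Let ds n := - (coef_sin phi n.+1 - coef_sin psi n.+1).

Let heat_T (kap th : R) (a d : nat -> R) (x : R) : 0 < kap -> (forall n, a n = n.+1%:R ^+ 3 * d n) ->
  heat kap th (damped kap T a) x T = fun n => d n * mode n.+1 th x.
Proof.
move=> k0 ad; apply/funext => n; rewrite /heat /damped ad.
have D0 := one_sub_expR_gt0 n k0 T0; have n0 : 0 < n.+1%:R :> R by [].
 congr (_ * _); move: (1 - _) D0 => D D0; move: (n.+1%:R) n0 => k kk0.
by field; rewrite !gt_eqF.
Qed.

Let acE n : ac n = n.+1%:R ^+ 3 * dc n.
Proof.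
rewrite /ac (coef_sin_third phiC2 phi3w phi_per phi1_per phi2_per).
by rewrite (coef_sin_third psiC2 psi3w psi_per psi1_per psi2_per) -mulrBr.
Qed.

Let asE n : as_ n = n.+1%:R ^+ 3 * ds n.
Proof.
rewrite /as_ (coef_cos_third phiC2 phi3w phi_per phi1_per phi2_per).
by rewrite (coef_cos_third psiC2 psi3w psi_per psi1_per psi2_per) /ds; ring.
Qed.

Let coef_summable (a d : nat -> R) : (forall n, a n = n.+1%:R ^+ 3 * d n) ->
  cvgn (series (fun n => `|a n| / n.+1%:R)) -> cvgn (series (fun n => `|d n|)).
Proof.
move=> ad; apply: series_abs_cvg => n; rewrite normr_id ad normrM.
have n1 : 1 <= n.+1%:R :> R by rewrite ler1n.
have n0 : 0 < n.+1%:R :> R by [].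
rewrite ger0_norm ?exprn_ge0// mulrAC exprSr mulfK ?gt_eqF//.
by rewrite -[leLHS]mul1r ler_wpM2r// exprn_ege1.
Qed.

Let final_data x : - pi <= x <= pi -> series_u x T = psi x.
Proof.
move=> xpi; rewrite series_uE divff ?gt_eqF// mul1r.
rewrite (heat_T 0 x kc0 acE) (heat_T (pi / 2) x ks0 asE).
have sc := coef_summable acE ac_summable; have ss := coef_summable asE as_summable.
have cS th (d : nat -> R) : cvgn (series (fun n => `|d n|)) -> {within `[- pi, pi],
    continuous (fun x => limn (series (fun n => d n * mode n.+1 th x)))}.
  move=> sd; apply: (@within_continuous_series R _ _ (fun n x => d n * mode n.+1 th x)
    (fun n => `|d n|)) => // [n y|n y _].
    by apply: cvgM; [exact: cvg_cst|exact: continuous_mode].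
  by rewrite normrM ler_piMr// mode_le1.
have cC := cS 0 _ sc; have cSn := cS (pi / 2) _ ss.
have cphi := deriv_within_within_continuous phiC2.1.
have cpsi := deriv_within_within_continuous psiC2.1.
(* At t = T the time factors cancel the denominators, so the series become the plain Fourier series
   of phi - psi without its constant term, and [m] supplies that term. Hence all coefficients of [D]
   vanish. *)
pose D x := phi x + m - limn (series (fun n => dc n * mode n.+1 0 x))
  + limn (series (fun n => ds n * mode n.+1 (pi / 2) x)) - psi x.
suff /eqP : D x = 0 by rewrite subr_eq0 => /eqP.
have Iphi : intg (- pi) pi phi := continuous_integrable cphi.
have Ipsi : intg (- pi) pi psi := continuous_integrable cpsi.
have IC : intg (- pi) pi (fun x => limn (series (fun n => dc n * mode n.+1 0 x))) :=
  continuous_integrable cC.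
have IS : intg (- pi) pi (fun x => limn (series (fun n => ds n * mode n.+1 (pi / 2) x))) :=
  continuous_integrable cSn.
have Im : intg (- pi) pi (fun=> m) by apply: continuous_intg => y; exact: cvg_cst.
have I1 := intgD Iphi Im; have I2 := intgB I1 IC; have I3 := intgD I2 IS.
have cD : {within `[- pi, pi], continuous D}.
  move=> y; apply: cvgB; last exact: cpsi.
  apply: cvgD; last exact: cSn.
  apply: cvgB; last exact: cC.
  by apply: cvgD; [exact: cphi|exact: cvg_cst].
have DE k th : fcoef D k th = fcoef phi k th + (k == 0%N)%:R * (2 * m * cos th)
    - (if k is k'.+1 then dc k' else 0) * cos (0 - th)
    + (if k is k'.+1 then ds k' else 0) * cos (pi / 2 - th) - fcoef psi k th.
  rewrite /D (fcoefB k th I3 Ipsi) (fcoefD k th I2 IS) (fcoefB k th I1 IC).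
  by rewrite (fcoefD k th Iphi Im) fcoef_cst !fcoef_mode_series.
have D0 k : fcoef D k 0 = 0.
  rewrite DE subr0 subr0 cos_pihalf cos0; case: k => [|k] /=.
    by rewrite !fcoef0// cos0 /m; ring.
  by rewrite /dc !coef_cosE; ring.
have D1 k : fcoef D k (pi / 2) = 0.
  rewrite DE sub0r cosN subrr cos_pihalf cos0; case: k => [|k] /=.
    by rewrite !fcoef0// cos_pihalf; ring.
  by rewrite /ds !coef_sinE; ring.
apply: (fourier_unique cD) => // k th.
by rewrite (fcoefE k th (continuous_integrable cD)) D0 D1 !mulr0 addr0.
Qed.

Lemma series_regular_solution : regular_solution T eps phi psi series_u series_f.
Proof.
have pi0 := pi_gt0 R.
have [Dphi [Dphi1 cphi2]] := phiC2.
split.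
  have cc := @heat_src_continuous R kc 0 bc kc0 sbc (- pi) pi.
  have cs := @heat_src_continuous R ks (pi / 2) bs ks0 sbs (- pi) pi.
  have cr := within_continuous_reflect cphi2.
  rewrite (_ : series_f = fun x => - phi2 x + eps * phi2 (- x) + m / T
    - limn (series (heat_src kc 0 bc x)) + limn (series (heat_src ks (pi / 2) bs x))); last first.
    by apply/funext => x; rewrite /series_f f_cosE f_sinE.
  move=> x; apply: cvgD; last exact: cs.
  apply: cvgB; last exact: cc.
  apply: cvgD; last exact: cvg_cst.
  by apply: cvgD; [apply: cvgN; exact: cphi2|apply: cvgM; [exact: cvg_cst|exact: cr]].
have pdtE x t : Omega T (x, t) -> pdt series_u x t = ut x t.
  move=> /OmegaP[_ /andP[t0 _]]; have [_ <-] := Dt_series_u x t0.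
  by rewrite /pdt derive1E.
have pdxxE x t : Omega T (x, t) -> pdxx series_u x t = uxx x t.
  by move=> O; have [_ <-] := Dpdx O; rewrite /pdxx derive1E.
split.
  move=> x t O; have /OmegaP[xpi /andP[t0 _]] := O; split.
  - by have [] := Dt_series_u x t0.
  - have xpi' : - pi <= x <= pi by case/andP: xpi => ? ?; rewrite !ltW.
    by have [] := deriv_within_is_derive xpi (Dseries_u xpi' (ltW t0)).
  - by have [] := Dpdx O.
split.
  move=> p Op; split.
  - exact: (interior_continuous cu_bar).
  - by apply: (interior_continuous cut_bar) Op => -[x t]; exact: pdtE.
  - by apply: (interior_continuous cux_bar) Op => -[x t]; exact: pdxE.
  - by apply: (interior_continuous cuxx_bar) Op => -[x t]; exact: pdxxE.
split; first exact: cu_bar.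
split.
  exists ux; split.
  - by move=> x t /Omega_barP[xpi /andP[t0 _]]; exact: Dseries_u.
  - exact: cux_bar.
  - by move=> t _; rewrite /ux phi1_per !heat_x_per.
split.
  move=> x t O; have /OmegaP[xpi /andP[t0 tT]] := O.
  have ON : Omega T (- x, t).
    apply/OmegaP; rewrite t0 tT; split=> //.
    by case/andP: xpi => ? ?; apply/andP; split; lra.
  rewrite pdtE// !pdxxE// /series_f f_cosE f_sinE.
  (* Cosines are even (sg = 1) and sines odd (sg = -1), which matches the two decay rates to 1 - sg
     eps. *)
  have kcE : kc = 1 - 1 * eps by rewrite mul1r.
  have ksE : ks = 1 - -1 * eps by rewrite mulN1r opprK.
  rewrite -(@heat_equation R kc 0 bc kc0 sbc eps 1 x t (ltW t0) kcE (fun n => mode_even n.+1)).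
  rewrite -(@heat_equation R ks (pi / 2) bs ks0 sbs eps (-1) x t (ltW t0) ksE (fun n => mode_odd n.+1)).
  by rewrite /ut /uxx; ring.
split.
  move=> x xpi; split; last exact: final_data.
  by rewrite series_uE !heat_0 mul0r mul0r !addr0 subr0.
move=> t _; rewrite !series_uE phi_per !heat_per//.
Qed.

End Existence.

Theorem theorem3 (R : realType) (T eps : R)
  (phi phi1 phi2 phi3 psi psi1 psi2 psi3 : R -> R) :
  0 < T -> eps != 0 -> `|eps| < 1 ->
  C2_on (-pi) pi phi phi1 phi2 -> C2_on (-pi) pi psi psi1 psi2 ->
  weak_deriv_L2 (-pi) pi phi2 phi3 -> weak_deriv_L2 (-pi) pi psi2 psi3 ->
  phi (-pi) = phi pi -> phi1 (-pi) = phi1 pi -> phi2 (-pi) = phi2 pi ->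
  psi (-pi) = psi pi -> psi1 (-pi) = psi1 pi -> psi2 (-pi) = psi2 pi ->
  (exists u f, regular_solution T eps phi psi u f) /\
  (forall u f, regular_solution T eps phi psi u f ->
     (forall x t, -pi <= x <= pi -> 0 <= t <= T ->
        [/\ cvgn (series (u_cos_term T eps phi3 psi3 x t)),
            cvgn (series (u_sin_term T eps phi3 psi3 x t)) &
            u x t = phi x + t / T * (mean0 psi - mean0 phi)
                    - limn (series (u_cos_term T eps phi3 psi3 x t))
                    + limn (series (u_sin_term T eps phi3 psi3 x t))]) /\
     (forall x, -pi <= x <= pi ->
        [/\ cvgn (series (f_cos_term T eps phi3 psi3 x)),
            cvgn (series (f_sin_term T eps phi3 psi3 x)) &
            f x = - phi2 x + eps * phi2 (- x) + (mean0 psi - mean0 phi) / T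
                  - limn (series (f_cos_term T eps phi3 psi3 x))
                  + limn (series (f_sin_term T eps phi3 psi3 x))])).
Proof.
move=> T0 _ eps1 phiC2 psiC2 phi3w psi3w p0 p1 p2 q0 q1 q2.
have reg := series_regular_solution T0 eps1 phiC2 psiC2 phi3w psi3w p0 p1 p2 q0 q1 q2.
split; first by exists (series_u T eps phi phi3 psi psi3), (series_f T eps phi phi2 phi3 psi psi3).
(* Any regular solution agrees with the explicit one, for which the formulas hold by
   construction. *)
move=> u f /(regular_solution_unique T0)/(_ reg)[uE fE]; split.
  move=> x t xpi tT; have t0 : 0 <= t by case/andP: tT.
  split; [exact: u_cos_cvg phi3w psi3w _ _ t0|exact: u_sin_cvg phi3w psi3w _ _ t0|exact: uE].
move=> x xpi; split; [exact: f_cos_cvg phi3w psi3w _|exact: f_sin_cvg phi3w psi3w _|exact: fE].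
Qed.
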